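(* Let $n \geq 7$ be an integer, let $S = \{\pm a, \pm b, \pm c\} \subset \mathbb{Z}_n$ be such that $|S| = 6$ and $\langle S \rangle = \mathbb{Z}_n$, and let $\Gamma = \mathrm{Circ}(n; S)$. Suppose that all $j \in \mathcal{A}_n(S)$ are of type 1. Then $\Gamma$ is distance magic if and only if $n = 4n_0$ for some integer $n_0 \geq 2$ and at least one of the following holds: (i) there exists $q \in \mathbb{Z}_n^*$ such that $qS = \{\pm 1, \pm n_0, \pm (2n_0-1)\}$; (ii) there exists $q \in \mathbb{Z}_n^*$ such that $qS = \{\pm 2, \pm n_0, \pm (2n_0-2)\}$; (iii) $n_0 = dd'$ for odd and coprime integers $d, d'$ with $1 < d < d' < n_0$, and there exists $q \in \mathbb{Z}_n^*$ such that $qS = \{\pm 2, \pm n_0, \pm c'\}$, where $1 < c' < n$ is the unique solution of the system $c' \equiv 0 \pmod 4$, $c' \equiv 2 \pmod d$, $c' \equiv -2 \pmod{d'}$; (iv) $n_0 = dd'd''$ for odd and pairwise coprime integers $d, d', d''$ with $1 \leq d < d' < d'' < n_0$, and there exists $q \in \mathbb{Z}_n^*$ such that $qS = \{\pm d, \pm b', \pm c'\}$, where $b'$ is the smallest integer with $1 < b' < n$ satisfying $b' \equiv 2-d \pmod 4$, $b' \equiv 0 \pmod{d'}$, $b' \equiv -d \pmod{d''}$ and $\gcd(b',d) = 1$, and where $1 < c' < n$ is the unique solution of the system $c' \equiv 2-d \pmod 4$, $c' \equiv -b' \pmod d$, $c' \equiv -d \pmod{d'}$, $c' \equiv 0 \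pmod{d''}$.
   Context: $\mathbb{Z}_n$ is the ring of residue classes modulo $n$ (and its additive cyclic group), $\mathbb{Z}_n^*$ its group of units, $\langle S\rangle$ the additive subgroup generated by $S$, and $qS = \{qs : s \in S\}$. For $S \subset \mathbb{Z}_n$ with $S=-S$ and $0 \notin S$, the circulant $\mathrm{Circ}(n;S)$ is the graph with vertex set $\mathbb{Z}_n$ in which $i,j$ are adjacent iff $j-i \in S$. A graph $\Gamma=(V,E)$ of order $n$ is distance magic if there are a bijection $\ell\colon V \to \{1,\dots,n\}$ and a positive integer $\kappa$ with $\sum_{u \in N(v)} \ell(u) = \kappa$ for all $v \in V$, where $N(v)$ is the set of neighbors of $v$. For $0 \le j \le n-1$ let $\chi_j(x) = e^{2\pi \mathbf{i} jx/n}$ for $x \in \mathbb{Z}_n$ and $\chi_j(S) = \sum_{s\in S}\chi_j(s)$. Put $\mathcal{A}_n(S) = \{ j \in \{0,1,\dots,n-1\} : \chi_j(S) = 0\}$. Type 1: for $S=\{\pm a,\pm b,\pm c\}$ with $|S|=6$ and $j \in \mathcal{A}_n(S)$, let $r_a, r_b, r_c \in [0,1]$ be the unique numbers with $\cos(\pi r_s) = \cos(2\pi js/n)$ for $s \in \{a,b,c\}$, and let $r_1 \le r_2 \le r_3$ be these three numbers in nondecreasing order (so $\cos(r_1\pi)+\cos(r_2\pi)+\cos(r_3\pi)=0$). Then $j$ is of type 1 if $0 \le r_1 \le \frac12$, $r_2 = \frac12$, $r_3 = 1-r_1$. (A $j$ of type 1 is allowed to be simultaneously of some other type.) *)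

(* Defs.v *)
From mathcomp Require Import all_boot all_order all_algebra all_fingroup.
From mathcomp Require Import complex.
From mathcomp Require Import reals trigo.

Set Implicit Arguments.
Unset Strict Implicit.
Unset Printing Implicit Defensive.

Import Order.TTheory GRing.Theory Num.Theory.

Local Open Scope ring_scope.
Local Open Scope complex_scope.

Definition circ (n : nat) (S : {set 'Z_n}) : rel 'Z_n :=
  [rel i j | j - i \in S].

(* The two conditions on l say that it is a bijection V -> {1, ..., #|V|}. *)
Definition distance_magic (V : finType) (adj : rel V) : Prop :=
  exists l : V -> nat,
    [/\ injective l,
        forall k : nat, (1 <= k <= #|V|)%N <-> exists v, l v = k
      & exists2 kappa : nat, (0 < kappa)%N &
          forall v, (\sum_(u | adj v u) l u)%N = kappa].

Definition pm3 (n : nat) (a b c : 'Z_n) : {set 'Z_n} :=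
  [set a; - a; b; - b; c; - c].

Definition scale_set (n : nat) (q : 'Z_n) (S : {set 'Z_n}) : {set 'Z_n} :=
  [set q * s | s in S].

(* x is read through its representative in {0, ..., n-1}; cos and sin of the
   angle do not depend on that choice. *)
Definition angle (R : realType) (n j : nat) (x : 'Z_n) : R :=
  2 * pi * j%:R * (x : nat)%:R / n%:R.

Definition chi (R : realType) (n j : nat) (x : 'Z_n) : R[i] :=
  cos (angle R j x) +i* sin (angle R j x).

Definition chi_sum (R : realType) (n j : nat) (S : {set 'Z_n}) : R[i] :=
  \sum_(s in S) chi R j s.

Definition calA (R : realType) (n : nat) (S : {set 'Z_n}) : {set 'I_n} :=
  [set j : 'I_n | chi_sum R j S == 0].

(* At most one r satisfies this, since cos is injective on [0, pi]. *)
Definition is_ratio (R : realType) (n j : nat) (s : 'Z_n) (r : R) : Prop :=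
  0 <= r <= 1 /\ cos (pi * r) = cos (angle R j s).

Definition type1 (R : realType) (n : nat) (a b c : 'Z_n) (j : nat) : Prop :=
  exists ra rb rc : R,
    [/\ is_ratio j a ra, is_ratio j b rb & is_ratio j c rc] /\
    exists r1 r2 r3 : R,
      [/\ perm_eq [:: r1; r2; r3] [:: ra; rb; rc],
          r1 <= r2 <= r3,
          0 <= r1 <= 1 / 2,
          r2 = 1 / 2
        & r3 = 1 - r1].

Definition condition_i (n n0 : nat) (S : {set 'Z_n}) : Prop :=
  exists2 q : 'Z_n, q \is a GRing.unit &
    scale_set q S = pm3 1 n0%:R (2 * n0%:R - 1).

Definition condition_ii (n n0 : nat) (S : {set 'Z_n}) : Prop :=
  exists2 q : 'Z_n, q \is a GRing.unit &
    scale_set q S = pm3 2 n0%:R (2 * n0%:R - 2).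

(* The congruences below are stated over int, hence the negative residues. *)
Definition c'_system_iii (n d d' : nat) (c' : nat) : Prop :=
  [/\ (1 < c' < n)%N,
      (c' = 0 %[mod 4])%Z,
      (c' = 2 %[mod d])%Z
    & (c' = - 2 %[mod d'])%Z].

Definition condition_iii (n n0 : nat) (S : {set 'Z_n}) : Prop :=
  exists d d' : nat,
    [/\ n0 = (d * d')%N,
        odd d && odd d',
        coprime d d'
      & (1 < d < d')%N && (d' < n0)%N] /\
    exists2 c' : nat, unique (c'_system_iii n d d') c' &
      exists2 q : 'Z_n, q \is a GRing.unit &
        scale_set q S = pm3 2 n0%:R c'%:R.

Definition b'_system_iv (n d d' d'' : nat) (b' : nat) : Prop :=
  [/\ (1 < b' < n)%N,
      (b' = 2 - d%:Z %[mod 4])%Z,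
      (b' = 0 %[mod d'])%Z,
      (b' = - d%:Z %[mod d''])%Z
    & gcdn b' d = 1%N].

Definition c'_system_iv (n d d' d'' b' : nat) (c' : nat) : Prop :=
  [/\ (1 < c' < n)%N,
      (c' = 2 - d%:Z %[mod 4])%Z,
      (c' = - b'%:Z %[mod d])%Z,
      (c' = - d%:Z %[mod d'])%Z
    & (c' = 0 %[mod d''])%Z].

Definition smallest (P : nat -> Prop) (m : nat) : Prop :=
  P m /\ forall k, P k -> (m <= k)%N.

Definition condition_iv (n n0 : nat) (S : {set 'Z_n}) : Prop :=
  exists d d' d'' : nat,
    [/\ n0 = (d * d' * d'')%N,
        [&& odd d, odd d' & odd d''],
        [&& coprime d d', coprime d d'' & coprime d' d'']
      & [&& 1 <= d, d < d', d' < d'' & d'' < n0]%N] /\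
    exists2 b' : nat, smallest (b'_system_iv n d d' d'') b' &
    exists2 c' : nat, unique (c'_system_iv n d d' d'' b') c' &
    exists2 q : 'Z_n, q \is a GRing.unit &
      scale_set q S = pm3 d%:R b'%:R c'%:R.

(* Main.v *)
Require Import Defs.
From mathcomp Require Import all_boot all_order all_algebra all_fingroup.
From mathcomp Require Import complex.
From mathcomp Require Import boolp reals trigo.
From mathcomp Require Import ring lra zify.

(** The neighbourhood sums of a labelling are constant iff, up to an additive
    constant, it is a combination of the characters chi_j with j in A_n(S).  An
    injective labelling has no nonzero period, so for every prime p | n some such
    j is prime to p.  Type 1 makes n = 4N and turns j into congruences: for one
    of the generators, say x, and the other two y, z, jx is an odd multiple of N
    and j(y -+ z) = 2N modulo 4N.  If N is even, parity fixes x and the sign,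
    giving (i).  If N is odd, every prime power of N is attached to one generator
    and one sign; the resulting coprime factors of N give (i)-(iv).

    Conversely, if 2x = 2d and y -+ z = 2d modulo 4d, the six translates by
    +-x, +-y, +-z of a function F with F(t + 2d) = - F(t) cancel pairwise.  In
    each of (i)-(iv) the congruences hold either for d = N or for each of the
    coprime odd factors d of N, and in the latter case mixed radix digits of the
    residues modulo these factors give a labelling that is a sum of such F. *)

Set Implicit Arguments.
Unset Strict Implicit.
Unset Printing Implicit Defensive.

Import Order.TTheory GRing.Theory Num.Theory.

Local Open Scope ring_scope.

(** * Characters of the cyclic group *)

Section Characters.
Variables (R : realType) (n : nat).
Hypothesis n_gt1 : (1 < n)%N.

Local Open Scope complex_scope.

Definition cis (t : R) : R[i] := cos t +i* sin t.

Lemma cisD s t : cis (s + t) = cis s * cis t.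
Proof. by rewrite /cis cosD sinD; apply/eqP; rewrite eq_complex /= !eqxx addrC eqxx. Qed.

Lemma cis0 : cis 0 = 1. Proof. by rewrite /cis cos0 sin0. Qed.

Lemma cisMn t k : cis (t *+ k) = cis t ^+ k.
Proof. by elim: k => [|k IHk]; rewrite ?cis0 // mulrS cisD IHk exprS. Qed.

Definition zeta : R[i] := cis (2 * pi / n%:R).

Lemma chiE j (x : 'Z_n) : chi R j x = zeta ^+ (j * x).
Proof.
rewrite -cisMn /chi /angle -/(cis _); congr cis.
by rewrite -[RHS]mulr_natr natrM; ring.
Qed.

Lemma zeta_prim : n.-primitive_root zeta.
Proof.
have n_gt0 : (0 < n)%N by apply: ltnW.
have nz_n : n%:R != 0 :> R by rewrite pnatr_eq0 -lt0n.
have zetan : zeta ^+ n = 1.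
  rewrite -cisMn; have -> : 2 * pi / n%:R *+ n = pi *+ 2 :> R.
    by rewrite -[LHS]mulr_natr divfK // mulr_natl.
  by rewrite /cis cos2pi sin2pi.
apply/andP; split=> //; apply/forallP=> -[i ltin] /=.
have [->|ne_i] := eqVneq i.+1 n; first by rewrite unity_rootE zetan eqxx.
rewrite unity_rootE -cisMn; apply/eqP/negbTE/eqP=> -[cos1 _].
have lt_i : (i.+1 < n)%N by rewrite ltn_neqAle ne_i.
(* [t] is half the argument of [zeta ^+ i.+1] and lies strictly between 0 and pi, so [sin t] is
   positive, whereas [cos (t *+ 2) = 1] forces [sin t = 0]. *)
pose t : R := pi * i.+1%:R / n%:R.
have tE : 2 * pi / n%:R *+ i.+1 = t *+ 2 by rewrite -[LHS]mulr_natr -[RHS]mulr_natr /t; ring.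
have : 0 < sin t.
  apply: sin_gt0_pi; rewrite divr_gt0 ?mulr_gt0 ?pi_gt0 ?ltr0n //=.
  by rewrite ltr_pdivrMr ?ltr0n // ltr_pM2l ?pi_gt0 // ltr_nat.
have := cos1; rewrite tE cos_mulr2n cos2sin2 => e s_gt0.
suff: sin t ^+ 2 = 0 by move/eqP; rewrite sqrf_eq0 gt_eqF.
lra.
Qed.

Lemma chiD j (x y : 'Z_n) : chi R j (x + y) = chi R j x * chi R j y.
Proof.
rewrite !chiE -exprD -mulnDr; apply/eqP.
by rewrite (eq_prim_root_expr zeta_prim) /= [X in (_ * (_ %% X))%N]Zp_cast // modnMmr.
Qed.

Lemma chi_eq1 j (x : 'Z_n) : (chi R j x == 1) = (n %| j * x)%N.
Proof. by rewrite chiE -(prim_order_dvd zeta_prim). Qed.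

Lemma sum_chi (x : 'Z_n) : \sum_(j < n) chi R j x = if x == 0 then n%:R else 0.
Proof.
case: eqVneq => [->|nz_x].
  rewrite (eq_bigr (fun=> 1)) => [|j _]; last by rewrite chiE muln0 expr0.
  by rewrite sumr_const card_ord.
have chi_ne1 : zeta ^+ x - 1 != 0.
  have := chi_eq1 1 x; rewrite chiE mul1n subr_eq0 => ->.
  apply: contra nz_x => dvd_nx; apply/eqP/val_inj => /=.
  move: dvd_nx; have := ltn_ord x; rewrite [X in (_ < X)%N]Zp_cast // => lt_xn.
  by rewrite /dvdn modn_small // => /eqP.
(* A geometric sum with ratio [zeta ^+ x], multiplied by its ratio minus one. *)
apply: (mulfI chi_ne1); rewrite mulr0.
rewrite (eq_bigr (fun j : 'I_n => (zeta ^+ x) ^+ j)) => [|j _].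
  by rewrite -subrX1 -exprM mulnC exprM (prim_expr_order zeta_prim) expr1n subrr.
by rewrite chiE mulnC exprM.
Qed.

(** Fourier inversion: by orthogonality of the characters, summing the coefficients against
    [chi R j x] over all [j] returns [n] times [f x]. *)
Lemma fourier_inj (f : 'Z_n -> R[i]) :
  (forall j : 'I_n, \sum_v f v * chi R j (- v) = 0) -> forall v, f v = 0.
Proof.
move=> f0 x; apply: (mulfI (prim_root_natf_neq0 zeta_prim)); rewrite mulr0.
transitivity (\sum_(j < n) (\sum_v f v * chi R j (- v)) * chi R j x); last first.
  by rewrite big1 // => j _; rewrite f0 mul0r.
under [RHS]eq_bigr do rewrite big_distrl /=.
rewrite [RHS]exchange_big /= [RHS](bigD1 x) //= [X in _ + X]big1 => [|v ne_vx]; last first.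
  under eq_bigr do rewrite -mulrA -chiD.
  by rewrite -mulr_sumr sum_chi addrC subr_eq0 eq_sym (negPf ne_vx) mulr0.
rewrite addr0; under [RHS]eq_bigr do rewrite -mulrA -chiD addNr.
by rewrite -mulr_sumr sum_chi eqxx mulrC.
Qed.

Lemma sum_neighbours (M : nmodType) (S : {set 'Z_n}) (f : 'Z_n -> M) v :
  \sum_(u | circ S v u) f u = \sum_(s in S) f (v + s).
Proof.
rewrite (reindex (fun s => v + s)) /=; last first.
  by exists (fun u => u - v) => u _; rewrite 1?addrC ?addKr ?subrK // addrC addKr.
by apply: eq_bigl => s; rewrite /circ /= addrC addKr.
Qed.

(* A periodic labelling would not be injective. *)
Lemma calA_separates (S : {set 'Z_n}) (p : nat) :
  distance_magic (circ S) -> prime p -> (p %| n)%N ->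
  exists2 j : 'I_n, j \in calA R S & ~~ (p %| j)%N.
Proof.
move=> [l [l_inj _ [kappa _ lS]]] p_pr p_n; apply/exists_inP.
apply: contraT => /exists_inPn calA_p.
have {}calA_p (j : 'I_n) : j \in calA R S -> (p %| j)%N.
  by move=> jA; have := calA_p j jA; rewrite negbK.
(* The candidate period: [p * h = 0], so [chi R j h = 1] whenever [p] divides [j]. *)
pose h : 'Z_n := (n %/ p)%:R.
have n_gt0 : (0 < n)%N by apply: ltnW.
have h_val : h = (n %/ p)%N :> nat.
  by rewrite val_Zp_nat // modn_small // ltn_Pdiv // prime_gt1.
have h_ne0 : h != 0.
  apply/eqP => h0; move: h_val; rewrite h0 /= => /esym/eqP.
  by rewrite eqn0Ngt divn_gt0 ?prime_gt0 // dvdn_leq.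
(* If this difference vanishes at 0, injectivity of [l] gives [h = 0]. *)
pose f (v : 'Z_n) : R[i] := (l (v + h))%:R - (l v)%:R.
suff f0 : forall v, f v = 0.
  case/negP: h_ne0; apply/eqP.
  have /eqP := f0 0; rewrite subr_eq0 eqr_nat => /eqP/l_inj.
  by rewrite add0r.
apply: fourier_inj => j.
have [jA|jNA] := boolP (j \in calA R S).
  have chi_h : chi R j h = 1.
    apply/eqP; rewrite chi_eq1 h_val.
    by have /dvdnP[k ->] := calA_p j jA; rewrite -mulnA mulnC [(p * _)%N]mulnC divnK // dvdn_mulr.
  under eq_bigr do rewrite mulrBl.
  rewrite sumrB; apply/eqP; rewrite subr_eq0; apply/eqP.
  rewrite [RHS](reindex_inj (addIr h)) /=; apply: eq_bigr => v _.
  have -> : chi R j (- v) = chi R j (- (v + h)) * chi R j h by rewrite -chiD opprD addrNK.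
  by rewrite chi_h mulr1.
(* Both translates of [l] have neighbour sum [kappa]. Taking Fourier coefficients turns this
   convolution into a product with [chi_sum R j S], which is nonzero for the [j] at hand. *)
have fS v : \sum_(s in S) f (v + s) = 0.
  rewrite /f sumrB; apply/eqP; rewrite subr_eq0; apply/eqP.
  transitivity (kappa%:R : R[i]).
    rewrite -(lS (v + h)) sum_neighbours natr_sum.
    by apply: eq_bigr => s _; rewrite addrAC.
  by rewrite -(lS v) sum_neighbours natr_sum.
have chi_nz : chi_sum R j S != 0 by rewrite inE in jNA.
apply: (mulfI chi_nz); rewrite mulr0.
transitivity (\sum_v (\sum_(s in S) f (v + s)) * chi R j (- v)); last first.
  by rewrite big1 // => v _; rewrite fS mul0r.
under [RHS]eq_bigr do rewrite big_distrl /=.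
rewrite [RHS]exchange_big /= /chi_sum big_distrl /=; apply: eq_bigr => s _.
rewrite big_distrr [LHS](reindex_inj (addIr s)) /=; apply: eq_bigr => v _.
by rewrite mulrCA -chiD opprD addrCA subrr addr0.
Qed.

(** The character value is purely imaginary of modulus one, so its square is -1. *)
Lemma cos_eq0_root j (x : 'Z_n) : cos (angle R j x) = 0 -> zeta ^+ (2 * (j * x)) = -1.
Proof.
move=> cos0; rewrite mulnC exprM -chiE /chi cos0 expr2.
have := cos2Dsin2 (angle R j x); rewrite cos0 expr0n add0r expr2 => s2.
by apply/eqP; rewrite eq_complex /= s2 mul0r mulr0 mul0r addr0 sub0r oppr0 !eqxx.
Qed.

(** Opposite cosines have sines equal up to sign. Opposite sines make the two roots opposite; equal
    sines make their product -1. *)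
Lemma cosN_root j (x y : 'Z_n) : cos (angle R j x) + cos (angle R j y) = 0 ->
  zeta ^+ (j * x) = - zeta ^+ (j * y) \/ zeta ^+ (j * x + j * y) = -1.
Proof.
move/eqP; rewrite addr_eq0 => /eqP cosE.
have /eqP : sin (angle R j x) ^+ 2 = sin (angle R j y) ^+ 2.
  by rewrite !sin2cos2 cosE sqrrN.
rewrite eqf_sqr => /orP[] /eqP sinE; [right|left]; rewrite ?exprD -!chiE /chi cosE sinE.
  have := cos2Dsin2 (angle R j y); rewrite !expr2 => cs.
  apply/eqP; rewrite eq_complex /=; apply/andP; split; apply/eqP; last by ring.
  by rewrite -cs; ring.
by apply/eqP; rewrite eq_complex /= !eqxx.
Qed.

End Characters.

(** * Divisibility and residues *)

Section Divisibility.

Lemma Euclid_dvdzM (p : nat) (x y : int) :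
  prime p -> (p %| x * y)%Z = (p %| x)%Z || (p %| y)%Z.
Proof. by move=> p_pr; rewrite !dvdzE abszM Euclid_dvdM. Qed.

Lemma coprimez_primes (x y : int) : x != 0 ->
  (forall p : nat, prime p -> (p %| x)%Z -> (p %| y)%Z -> False) -> coprimez x y.
Proof.
move=> x_nz xy; rewrite coprimezE /coprime; apply/eqP.
have g_gt0 : (0 < gcdn `|x| `|y|)%N by rewrite gcdn_gt0 absz_gt0 x_nz.
apply/eqP; rewrite eqn_leq g_gt0 andbT leqNgt; apply/negP => g_gt1.
apply: (xy _ (pdiv_prime g_gt1)); rewrite dvdzE absz_nat.
  exact: dvdn_trans (pdiv_dvd _) (dvdn_gcdl _ _).
exact: dvdn_trans (pdiv_dvd _) (dvdn_gcdr _ _).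
Qed.

(* The multipliers [j] generate the unit ideal modulo [N]. *)
Lemma dvdz_by_primes (N : nat) (x : int) : (0 < N)%N ->
  (forall p : nat, prime p -> (p %| N)%N ->
     exists2 j : int, ~~ (p %| j)%Z & (N %| j * x)%Z) ->
  (N %| x)%Z.
Proof.
move=> N_gt0 Nx; rewrite dvdzE absz_nat.
have g_gt0 : (0 < gcdn N `|x|)%N by rewrite gcdn_gt0 N_gt0.
have [/divnK Nk /divnK xk] := (dvdn_gcdl N `|x|, dvdn_gcdr N `|x|).
have [k_le1|k_gt1] := leqP (N %/ gcdn N `|x|) 1.
  suff /eqP k1 : (N %/ gcdn N `|x|)%N == 1%N.
    by rewrite -{1}Nk k1 mul1n dvdn_gcdr.
  by rewrite eqn_leq k_le1 divn_gt0 // dvdn_leq ?dvdn_gcdl.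
(* A prime dividing the cofactor of the gcd in [N] would divide the multiplier [j] chosen for it,
   because this cofactor is prime to the cofactor of the gcd in [x]. *)
have pk := pdiv_dvd (N %/ gcdn N `|x|).
have pN : (pdiv (N %/ gcdn N `|x|) %| N)%N by rewrite -[X in (_ %| X)%N]Nk dvdn_mulr.
have [j] := Nx _ (pdiv_prime k_gt1) pN.
rewrite !dvdzE abszM !absz_nat => /negP pNj Njx; case: pNj.
move: Njx; rewrite -[X in (X %| _)%N]Nk -[X in (_ %| _ * X)%N]xk mulnA dvdn_pmul2r // Gauss_dvdl.
  exact: dvdn_trans.
by rewrite /coprime -(eqn_pmul2r g_gt0) muln_gcdl Nk xk mul1n.
Qed.

Lemma chinese_exists (m1 m2 r1 r2 : int) : coprimez m1 m2 ->
  exists q : int, (m1 %| q - r1)%Z && (m2 %| q - r2)%Z.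
Proof.
move=> co12; exists (zchinese m1 m2 r1 r2).
by rewrite -!eqz_mod_dvd zchinese_modl // zchinese_modr // !eqxx.
Qed.

Lemma inverse_mod (m x : int) : coprimez x m -> exists u : int, (m %| u * x - 1)%Z.
Proof.
move=> /coprimezP[[u v] /= uv]; exists u.
by apply/dvdzP; exists (- v); rewrite -uv; ring.
Qed.

Lemma coprimez_mod (m x y : int) : (m %| x - y)%Z -> coprimez x m = coprimez y m.
Proof.
move=> /dvdzP[k xy]; have -> : x = k * m + y by rewrite -xy subrK.
by rewrite /coprimez [gcdz _ m]gcdzC gcdzMDl [gcdz m y]gcdzC.
Qed.

Lemma eqz_modP (x y d : int) : (x = y %[mod d])%Z <-> (d %| x - y)%Z.
Proof. by rewrite -eqz_mod_dvd; split=> /eqP. Qed.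

(** Produces the unit [q] that normalises the connection set: modulo each factor take the target
    times an inverse of the source, then glue by the Chinese remainder theorem. *)
Lemma unit_mult (m1 m2 x1 y1 x2 y2 : int) : coprimez m1 m2 ->
  coprimez x1 m1 -> coprimez y1 m1 -> coprimez x2 m2 -> coprimez y2 m2 ->
  exists2 q : int, coprimez q (m1 * m2) & (m1 %| q * x1 - y1)%Z && (m2 %| q * x2 - y2)%Z.
Proof.
move=> co12 cox1 coy1 cox2 coy2.
have step m x y q u : (m %| u * x - 1)%Z -> (m %| q - u * y)%Z -> (m %| q * x - y)%Z.
  move=> ux qu; have -> : q * x - y = (q - u * y) * x + (u * x - 1) * y by ring.
  by rewrite rpredD // dvdz_mulr.
have co m x y q : (m %| q * x - y)%Z -> coprimez y m -> coprimez q m.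
  by move=> /coprimez_mod <-; rewrite coprimezMl => /andP[].
have [u1 ux1] := inverse_mod cox1; have [u2 ux2] := inverse_mod cox2.
have [q /andP[q1 q2]] := chinese_exists (u1 * y1) (u2 * y2) co12.
have [q1' q2'] := (step _ _ _ _ _ ux1 q1, step _ _ _ _ _ ux2 q2).
by exists q; rewrite ?coprimezMr ?(co _ _ _ _ q1') ?(co _ _ _ _ q2') // q1' q2'.
Qed.

Lemma smallest_exists (P : nat -> Prop) : (exists m, P m) -> exists m, smallest P m.
Proof.
move=> [m Pm]; have exP : exists i, `[< P i >] by exists m; apply/asboolP.
case: (ex_minnP exP) => k /asboolP Pk mink; exists k; split=> // i Pi.
by apply: mink; apply/asboolP.
Qed.

End Divisibility.

Section Residues.
Variable n : nat.
Hypothesis n_gt1 : (1 < n)%N.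

Lemma intr_Zp_eq0 (x : int) : (x%:~R == 0 :> 'Z_n) = (n %| x)%Z.
Proof.
have natE (k : nat) : (k%:R == 0 :> 'Z_n) = (n %| k)%N.
  by rewrite -val_eqE /= val_Zp_nat.
by case: x => k; rewrite ?NegzE ?rmorphN /= ?oppr_eq0 -?pmulrn natE dvdzE ?abszN.
Qed.

Lemma intr_Zp_eq (x y : int) : (x%:~R == y%:~R :> 'Z_n) = (n %| x - y)%Z.
Proof. by rewrite -subr_eq0 -rmorphB intr_Zp_eq0. Qed.

Lemma intr_val (x : 'Z_n) : (x : nat)%:Z%:~R = x.
Proof. exact: natr_Zp. Qed.

(** Integer representatives allow signs and divisibility to be handled over [int]. *)
Definition pmz (a b c : int) : {set 'Z_n} := pm3 a%:~R b%:~R c%:~R.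

Lemma pmz_swap12 a b c : pmz a b c = pmz b a c.
Proof.
by apply/setP=> x; rewrite !inE -!orbA; do 6!case: (x == _).
Qed.

Lemma pmz_swap23 a b c : pmz a b c = pmz a c b.
Proof. by apply/setP=> x; rewrite !inE -!orbA; do 6!case: (x == _). Qed.

Lemma pmz_opp1 a b c : pmz (- a) b c = pmz a b c.
Proof.
by apply/setP=> x; rewrite !inE !rmorphN opprK -!orbA; do 6!case: (x == _).
Qed.

Lemma pmz_opp2 a b c : pmz a (- b) c = pmz a b c.
Proof. by rewrite pmz_swap12 pmz_opp1 pmz_swap12. Qed.

Lemma pmz_opp3 a b c : pmz a b (- c) = pmz a b c.
Proof. by rewrite pmz_swap23 pmz_opp2 pmz_swap23. Qed.

Lemma scale_pmz (q a b c a' b' c' : int) :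
  (n %| q * a - a')%Z -> (n %| q * b - b')%Z -> (n %| q * c - c')%Z ->
  scale_set q%:~R (pmz a b c) = pmz a' b' c'.
Proof.
rewrite -!intr_Zp_eq => /eqP qa /eqP qb /eqP qc.
rewrite /scale_set /pmz /pm3 -qa -qb -qc !imsetU !imset_set1.
by rewrite !mulrN -!rmorphM.
Qed.

Lemma unit_intr (q : int) : coprimez q n -> (q%:~R : 'Z_n) \is a GRing.unit.
Proof.
move=> /inverse_mod[u]; rewrite -intr_Zp_eq rmorphM mulrC => /eqP uq.
by apply/unitrPr; exists u%:~R.
Qed.

End Residues.

(** * Arithmetic of the spectrum *)

Section Roles.
Variable N : nat.
Hypothesis N_gt1 : (1 < N)%N.
Implicit Types j x y z : int.

(* For n = 4N this says cos(2 pi j x / n) = 0 and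
   cos(2 pi j y / n) + cos(2 pi j z / n) = 0. *)
Definition role (j x y z : int) : Prop :=
  (2 * N%:Z %| j * x - N%:Z)%Z /\
  ((4 * N%:Z %| j * (y - z) - 2 * N%:Z)%Z \/ (4 * N%:Z %| j * (y + z) - 2 * N%:Z)%Z).

(** Which generator has the vanishing cosine may change with [j]. *)
Definition roles (j x y z : int) : Prop :=
  [\/ role j x y z, role j y x z | role j z x y].

(** The two facts kept from a distance magic circulant: the spectrum separates the primes dividing
    [4 * N], and the connection set generates the whole group. *)
Definition admissible (x y z : int) : Prop :=
  (forall p : nat, prime p -> (p %| 4 * N)%N ->
     exists2 j : int, ~~ (p %| j)%Z & roles j x y z) /\
  (forall p : nat, prime p -> (p %| 4 * N)%N ->
     (p %| x)%Z -> (p %| y)%Z -> (p %| z)%Z -> False).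

(** * Invariance under permutations and sign changes of the generators *)

Lemma role_swap j x y z : role j x y z -> role j x z y.
Proof.
move=> [jx jyz]; split=> //; case: jyz => /dvdzP[k jyz]; [left|right]; apply/dvdzP.
  exists (- k - 1); rewrite mulrBl mulNr -jyz; ring.
by exists k; rewrite -jyz; ring.
Qed.

Lemma role_opp1 j x y z : role j x y z -> role j (- x) y z.
Proof.
move=> [/dvdzP[k jx] jyz]; split=> //; apply/dvdzP.
exists (- k - 1); rewrite mulrBl mulNr -jx; ring.
Qed.

Lemma role_opp2 j x y z : role j x y z -> role j x (- y) z.
Proof.
move=> [jx jyz]; split=> //; case: jyz => /dvdzP[k jyz]; [right|left]; apply/dvdzP.
  exists (- k - 1); rewrite mulrBl mulNr -jyz; ring.
by exists (- k - 1); rewrite mulrBl mulNr -jyz; ring.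
Qed.

Lemma roles_swap12 j x y z : roles j x y z -> roles j y x z.
Proof.
by case=> r; [apply: Or32 | apply: Or31 | apply: Or33; apply: role_swap].
Qed.

Lemma roles_swap23 j x y z : roles j x y z -> roles j x z y.
Proof.
by case=> r; [apply: Or31; apply: role_swap | apply: Or33 | apply: Or32].
Qed.

Lemma roles_opp1 j x y z : roles j x y z -> roles j (- x) y z.
Proof.
case=> r; first by apply: Or31; apply: role_opp1.
  by apply: Or32; apply: role_opp2.
by apply: Or33; apply: role_opp2.
Qed.

Lemma admissible_swap12 x y z : admissible x y z -> admissible y x z.
Proof.
move=> [sp gn]; split=> p p_pr p4N; last by move=> py px; apply: gn px py.
by have [j pj /roles_swap12] := sp p p_pr p4N; exists j.
Qed.

Lemma admissible_swap23 x y z : admissible x y z -> admissible x z y.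
Proof.
move=> [sp gn]; split=> p p_pr p4N; last by move=> px pz py; apply: gn px py pz.
by have [j pj /roles_swap23] := sp p p_pr p4N; exists j.
Qed.

Lemma admissible_opp1 x y z : admissible x y z -> admissible (- x) y z.
Proof.
move=> [sp gn]; split=> p p_pr p4N.
  by have [j pj /roles_opp1] := sp p p_pr p4N; exists j.
by rewrite dvdzE abszN; apply: gn.
Qed.

Lemma admissible_opp2 x y z : admissible x y z -> admissible x (- y) z.
Proof. by move=> /admissible_swap12/admissible_opp1/admissible_swap12. Qed.

Lemma admissible_opp3 x y z : admissible x y z -> admissible x y (- z).
Proof. by move=> /admissible_swap23/admissible_opp2/admissible_swap23. Qed.

Lemma Z4N_gt1 : (1 < 4 * N)%N. Proof. by lia. Qed.

Definition classified (x y z : int) : Prop :=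
  let S := pmz (4 * N) x y z in
  [\/ condition_i N S, condition_ii N S, condition_iii N S | condition_iv N S].

Lemma classified_swap12 x y z : classified x y z -> classified y x z.
Proof. by rewrite /classified pmz_swap12. Qed.

Lemma classified_swap23 x y z : classified x y z -> classified x z y.
Proof. by rewrite /classified pmz_swap23. Qed.

Lemma classified_opp1 x y z : classified (- x) y z -> classified x y z.
Proof. by rewrite /classified pmz_opp1. Qed.

Lemma classified_opp2 x y z : classified x (- y) z -> classified x y z.
Proof. by rewrite /classified pmz_opp2. Qed.

Lemma classified_opp3 x y z : classified x y (- z) -> classified x y z.
Proof. by rewrite /classified pmz_opp3. Qed.

(** An odd factor is 1 or -1 modulo 4. *)
Lemma dvdz_odd_mult (x : int) : (2 * N%:Z %| x - N%:Z)%Z ->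
  (4 * N%:Z %| x - N%:Z)%Z \/ (4 * N%:Z %| - x - N%:Z)%Z.
Proof.
move=> /dvdzP[k xk]; have [k2|k2] : (2 %| k)%Z \/ (2 %| k + 1)%Z by lia.
  by case/dvdzP: k2 xk => h -> xk; left; apply/dvdzP; exists h; rewrite xk; ring.
case/dvdzP: k2 => h k2; right; apply/dvdzP; exists (- h).
have -> : x = k * (2 * N%:Z) + N%:Z by rewrite -xk; ring.
have -> : k = h * 2 - 1 by rewrite -k2; ring.
ring.
Qed.

Lemma dvdz_odd_mulr (x q : int) : (2 * N%:Z %| x - N%:Z)%Z -> (2 %| q - 1)%Z ->
  (2 * N%:Z %| q * x - N%:Z)%Z.
Proof.
move=> /dvdzP[k xk] /dvdzP[h qh]; apply/dvdzP; exists (h + q * k).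
have -> : x = k * (2 * N%:Z) + N%:Z by rewrite -xk; ring.
have -> : q = h * 2 + 1 by rewrite -qh; ring.
ring.
Qed.

(** Multiply by an inverse [q] of [y]. Being odd, [q] fixes the class of [2 * N] modulo [4 * N] and
    sends [x] to plus or minus [N], while [z] goes to [1 - 2 * N]. *)
Lemma condition_i_intro x y z : coprimez y (4 * N%:Z) ->
  (2 * N%:Z %| x - N%:Z)%Z -> (4 * N%:Z %| y - z - 2 * N%:Z)%Z ->
  condition_i N (pmz (4 * N) x y z).
Proof.
move=> co_y xN yzN.
have co1 (u : int) : coprimez u 1 by rewrite coprimezE coprimen1.
(* With second modulus 1 this is just an inverse of [y] modulo [4 * N]. *)
have [|q] := @unit_mult (4 * N%:Z) 1 y 1 1 1 (co1 _) co_y _ (co1 _) (co1 _).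
  by rewrite coprimez_sym.
rewrite mulr1 => co_q /andP[qy _].
have q_odd : (2 %| q - 1)%Z.
  have := co_q; rewrite coprimezMr => /andP[+ _].
  by rewrite coprimezE -[X in coprime _ X]/(2 ^ 2)%N coprime_pexpr // coprimen2; clear; lia.
exists q%:~R; first exact: (unit_intr Z4N_gt1).
have -> : pm3 1 N%:R (2 * N%:R - 1) = pmz (4 * N) 1 N (2 * N%:Z - 1).
  by rewrite /pmz rmorphB rmorphM /= -!pmulrn.
rewrite pmz_swap12 -[in RHS]pmz_opp3.
have qz : (4 * N%:Z %| q * z - - (2 * N%:Z - 1))%Z.
  case/dvdzP: qy => k qy; case/dvdzP: yzN => h yz; case/dvdzP: q_odd => m q1.
  apply/dvdzP; exists (k - q * h - m).
  have -> : z = y - 2 * N%:Z - h * (4 * N%:Z) by rewrite -yz; ring.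
  transitivity ((q * y - 1) - (q - 1) * (2 * N%:Z) - q * h * (4 * N%:Z)); first ring.
  by rewrite qy q1; ring.
have [qx|qx] := dvdz_odd_mult (dvdz_odd_mulr xN q_odd).
  exact: (scale_pmz Z4N_gt1).
rewrite -[in RHS]pmz_opp2; apply: (scale_pmz Z4N_gt1) => //.
by case/dvdzP: qx => k qx; apply/dvdzP; exists (- k); rewrite mulNr -qx; ring.
Qed.

Let N_gt0 : (0 < N)%N. Proof. exact: ltnW. Qed.
Let N_nz : N%:Z != 0. Proof. by lia. Qed.

Let N2_nz : 2 * N%:Z != 0. Proof. by lia. Qed.
Let N4_nz : 4 * N%:Z != 0. Proof. by lia. Qed.

Lemma odd_cofactor j (e k : int) : j * e = 2 * k + 1 -> exists h : int, e = 2 * h + 1.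
Proof.
move=> je; have e_odd : ~~ (2 %| e)%Z.
  apply/negP => e2; have := @Euclid_dvdzM 2 j e isT.
  by rewrite e2 orbT je; clear; lia.
by exists (e %/ 2)%Z; move: e_odd; clear; lia.
Qed.

Lemma prime_dvd4N (p : nat) : prime p -> (p %| 4 * N)%N -> p = 2%N \/ (p %| N)%N.
Proof.
move=> p_pr; rewrite (Euclid_dvdM 4) // => /orP[|pN]; last by right.
by rewrite (Euclid_dvdX 2 2) // dvdn_prime2 // => /andP[/eqP-> _]; left.
Qed.

Lemma role_odd_mult j x y z : role j x y z ->
  exists k : int, j * x = N%:Z * (2 * k + 1).
Proof. by case=> /dvdzP[k jx] _; exists k; rewrite -[LHS](subrK N%:Z) jx; ring. Qed.

Lemma dvdz_oddP (m : int) : (4 * N%:Z %| m - 2 * N%:Z)%Z ->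
  exists k : int, m = 2 * N%:Z * (2 * k + 1).
Proof. by case/dvdzP=> k mk; exists k; rewrite -[LHS](subrK (2 * N%:Z)) mk; ring. Qed.

(* Every multiplier plays the same role, with the same sign, as [j0]. *)
Lemma even_condition_i x y z (j0 : int) : (2 %| N)%N -> admissible x y z ->
  ~~ (2 %| j0)%Z -> (2 * N%:Z %| j0 * x - N%:Z)%Z ->
  (4 * N%:Z %| j0 * (y - z) - 2 * N%:Z)%Z ->
  condition_i N (pmz (4 * N) x y z).
Proof.
move=> N2 [sp gn] j0_odd j0x j0yz.
have [k0 j0xE] : exists k, j0 * x = N%:Z * (2 * k + 1).
  by case/dvdzP: j0x => k jx; exists k; rewrite -[LHS](subrK N%:Z) jx; ring.
have [l0 j0yzE] := dvdz_oddP j0yz.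
have evM (u v : int) : (2 %| u * v)%Z = (2 %| u)%Z || (2 %| v)%Z.
  exact: (@Euclid_dvdzM 2).
have x_even : (2 %| x)%Z.
  by move: (evM j0 x); rewrite (negPf j0_odd) /= => <-; rewrite j0xE dvdz_mulr.
have yz_even : (2 %| y - z)%Z.
  move: (evM j0 (y - z)); rewrite (negPf j0_odd) /= => <-.
  by rewrite j0yzE -mulrA dvdz_mulr.
have y_odd : ~~ (2 %| y)%Z.
  apply/negP => y_even; apply: (gn 2%N) => //; first by rewrite dvdn_mulr.
  by lia.
(* Eliminating [j] and [N] leaves an equation whose 2-adic valuations can be compared. *)
have cancel j k l u v : ~~ (j == 0) -> j * u = N%:Z * (2 * k + 1) ->
    j * v = 2 * N%:Z * (2 * l + 1) -> 2 * (2 * l + 1) * u = (2 * k + 1) * v.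
  move=> j_nz ju jv; apply: (mulfI j_nz).
  transitivity (2 * (2 * l + 1) * (j * u)); first by ring.
  by transitivity ((2 * k + 1) * (j * v)); [rewrite ju jv; ring | ring].
have j_nz j u k : j * u = N%:Z * (2 * k + 1) -> ~~ (j == 0).
  move=> ju; apply/eqP => j0E; move/esym/eqP: ju; rewrite j0E mul0r mulf_eq0.
  by rewrite (negPf N_nz) /=; lia.
have all_roles j : roles j x y z -> exists k l,
    j * x = N%:Z * (2 * k + 1) /\ j * (y - z) = 2 * N%:Z * (2 * l + 1).
  have no_role u v k l : ~~ (2 %| v)%Z -> j * u = N%:Z * (2 * k + 1) ->
      j * v = 2 * N%:Z * (2 * l + 1) -> False.
    move=> v_odd ju jv; have e := cancel _ _ _ _ _ (j_nz _ _ _ ju) ju jv.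
    have : (2 %| (2 * k + 1) * v)%Z by rewrite -e -mulrA dvdz_mulr.
    by rewrite evM; lia.
  case=> r; have [k jk] := role_odd_mult r; case: r => _ [] /dvdz_oddP[l jl].
  - by exists k, l.
  (* The opposite sign: as [x] is even, 4 would divide both [y + z] and [y - z], making [y] even. *)
  - exfalso; have e1 := cancel _ _ _ _ _ (j_nz _ _ _ jk) jk jl.
    have e0 := cancel _ _ _ _ _ (j_nz _ _ _ j0xE) j0xE j0yzE.
    have F4 (m h w : int) : 2 * (2 * h + 1) * x = (2 * m + 1) * w -> (4 %| w)%Z.
      move=> e; have co4 : coprimez 4 (2 * m + 1).
        rewrite (@coprimezXl 2 2 (2 * m + 1)) // coprimez_sym.
        by apply/coprimezP; exists (1, - m) => /=; ring.
      rewrite -(Gauss_dvdzr _ co4) -e; case/dvdzP: x_even => h' ->.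
      by apply/dvdzP; exists ((2 * h + 1) * h'); ring.
    by move: (F4 _ _ _ e1) (F4 _ _ _ e0) y_odd; clear; lia.
  (* In the other roles the sum or difference involves the even [x] and one odd generator, hence is
     odd. *)
  - by case: (no_role y (x - z) k l _ jk jl); lia.
  - by case: (no_role y (x + z) k l _ jk jl); lia.
  - by case: (no_role z (x - y) k l _ jk jl); lia.
  - by case: (no_role z (x + y) k l _ jk jl); lia.
have Nx : (N %| x)%Z.
  apply: dvdz_by_primes => // p p_pr pN.
  have [|j pj /all_roles[k [l [jx _]]]] := sp p p_pr; first by rewrite dvdn_mull.
  by exists j; rewrite // jx dvdz_mulr.
have N2yz : ((2 * N)%N %| y - z)%Z.
  apply: dvdz_by_primes => [|p p_pr pN]; first by rewrite muln_gt0.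
  have [|j pj /all_roles[k [l [_ jyz]]]] := sp p p_pr.
    by rewrite -[4%N]/(2 * 2)%N -mulnA dvdn_mull.
  by exists j; rewrite // jyz dvdz_mulr.
have co_y : coprimez y (4 * N%:Z).
  rewrite coprimez_sym; apply: coprimez_primes => // p p_pr p4N py.
  case: (prime_dvd4N p_pr p4N) => [p2|pN]; first by move: py; rewrite p2 (negPf y_odd).
  apply: (gn p p_pr p4N) => //; first by apply: dvdz_trans Nx.
  have -> : z = y - (y - z) by ring.
  rewrite rpredB //; apply: dvdz_trans N2yz.
  by rewrite dvdzE dvdn_mull.
apply: condition_i_intro => //.
  (* [N] divides [x] and [j0 * x / N] is odd, so the quotient [x / N] is odd too; the same argument
     then serves for [y - z] and [2 * N]. *)
  case/dvdzP: Nx => e xe; move: j0xE; rewrite xe mulrA [RHS]mulrC => /(mulIf N_nz) j0e.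
  have [h he] := odd_cofactor j0e.
  by apply/dvdzP; exists h; rewrite he; ring.
case/dvdzP: N2yz => e yze; move: j0yzE; rewrite yze PoszM mulrA [RHS]mulrC.
move/(mulIf N2_nz) => j0e; have [h he] := odd_cofactor j0e.
by apply/dvdzP; exists h; rewrite he; ring.
Qed.
Lemma dvdn_gcdM (m u v : nat) : (m %| u * v)%N -> (m %| gcdn m u * gcdn m v)%N.
Proof. by move=> muv; rewrite muln_gcdr dvdn_gcd dvdn_mull // muln_gcdl dvdn_gcd dvdn_mulr. Qed.

Lemma nat_residue x : exists2 m : nat, (m < 4 * N)%N & (4 * N%:Z %| m%:Z - x)%Z.
Proof.
have r_ge0 : 0 <= (x %% (4 * N%:Z))%Z by rewrite modz_ge0.
have r_lt : (x %% (4 * N%:Z))%Z < 4 * N%:Z by rewrite ltz_pmod //; lia.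
exists `|(x %% (4 * N%:Z))%Z|%N; first by rewrite -ltz_nat gez0_abs.
rewrite gez0_abs // {2}(divz_eq x (4 * N%:Z)).
by apply/dvdzP; exists (- (x %/ (4 * N%:Z))%Z); ring.
Qed.

Lemma eq_residue (m1 m2 : nat) : (m1 < 4 * N)%N -> (m2 < 4 * N)%N ->
  (4 * N%:Z %| m1%:Z - m2%:Z)%Z -> m1 = m2.
Proof.
move=> lt1 lt2; rewrite -eqz_mod_dvd -[4 * N%:Z]/((4 * N)%N%:Z) !modz_nat eqz_nat.
by rewrite !modn_small // => /eqP.
Qed.

(** * Odd [N]: splitting [N] into coprime factors attached to generators and signs *)

Section OddQuarter.
Hypothesis N_odd : odd N.

Let coN4 : coprimez 4 N.
Proof. by rewrite coprimezE (@coprimeXl 2 2 N) // coprime2n. Qed.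

Lemma dvd4N x : (4 * N%:Z %| x)%Z = (4 %| x)%Z && (N %| x)%Z.
Proof. exact: Gauss_dvdz. Qed.

Lemma role_dvdN j x y z : role j x y z -> (N %| j * x)%Z.
Proof. by case/role_odd_mult => k ->; rewrite dvdz_mulr. Qed.

(** Since [j * x] is an odd multiple of the odd [N], both [j] and [x] are odd. Cancelling the odd
    [j] then transfers the residue 2 modulo 4 to [y - z] or [y + z], leaving [j] only in the
    condition modulo [N]. *)
Lemma role_parity j x y z : role j x y z -> ~~ (2 %| x)%Z /\
  ((4 %| y - z - 2)%Z /\ (N %| j * (y - z))%Z \/ (4 %| y + z - 2)%Z /\ (N %| j * (y + z))%Z).
Proof.
have evM (u v : int) : (2 %| u * v)%Z = (2 %| u)%Z || (2 %| v)%Z.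
  exact: (@Euclid_dvdzM 2).
have oddN k : ~~ (2 %| N%:Z * (2 * k + 1))%Z.
  by rewrite evM negb_or dvdzE dvdn2 N_odd /=; clear; lia.
move=> r; have [k jx] := role_odd_mult r.
have := oddN k; rewrite -jx evM negb_or => /andP[j_odd x_odd]; split=> //.
have half l w : j * w = 2 * N%:Z * (2 * l + 1) -> (4 %| w - 2)%Z /\ (N %| j * w)%Z.
  move=> jw; split; last by rewrite jw -mulrA mulrCA dvdz_mulr.
  have : (2 %| w)%Z by move: (evM j w); rewrite (negPf j_odd) /= => <-; rewrite jw -mulrA dvdz_mulr.
  case/dvdzP=> h wh; move: (oddN l); have -> : N%:Z * (2 * l + 1) = j * h.
    by apply: (@mulfI _ 2) => //; rewrite mulrA -jw wh; ring.
  by rewrite evM negb_or wh => /andP[_]; clear; lia.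
by case: r => _ [] /dvdz_oddP[l /half]; [left|right].
Qed.

(** The only odd generator [x] takes the first role for every multiplier, so the prime powers of [N]
    split between [y - z] and [y + z]. This gives [N = d * d'], with condition (ii) if [d = 1] and
    condition (iii) otherwise. *)
Lemma even_pair_le x y z : admissible x y z -> ~~ (2 %| x)%Z ->
  (4 %| y - 2)%Z -> (4 %| z)%Z -> (gcdn N `|(y - z)%R| <= gcdn N `|(y + z)%R|)%N ->
  classified x y z.
Proof.
move=> [sp gn] x_odd y2 z4 le_dd'.
set d := gcdn N `|(y - z)%R|; set d' := gcdn N `|(y + z)%R|.
have y_even : (2 %| y)%Z by move: y2; clear; lia.
have z_even : (2 %| z)%Z by move: z4; clear; lia.
have all_roles j : roles j x y z ->
    (N %| j * x)%Z /\ ((N %| j * (y - z))%Z \/ (N %| j * (y + z))%Z).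
  case=> r; last 2 first.
  - by case: (role_parity r); rewrite y_even.
  - by case: (role_parity r); rewrite z_even.
  by split; [apply: role_dvdN r | case: (role_parity r) => _ [[_]|[_]]; [left|right]].
have p4N (p : nat) : (p %| N)%N -> (p %| 4 * N)%N by apply: dvdn_mull.
have Nx : (N %| x)%Z.
  apply: dvdz_by_primes => // p p_pr pN.
  by have [j pj /all_roles[jx _]] := sp p p_pr (p4N _ pN); exists j.
(* The sign may vary with [j]; the product covers both signs at once. *)
have Nyz : (N %| (y - z) * (y + z))%Z.
  apply: dvdz_by_primes => // p p_pr pN.
  have [j pj /all_roles[_ jyz]] := sp p p_pr (p4N _ pN); exists j => //.
  by case: jyz => jyz; [rewrite mulrA | rewrite mulrCA]; [apply: dvdz_mulr | apply: dvdz_mull].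
have dvd_x (p : nat) : (p %| N)%N -> (p %| x)%Z by move=> pN; apply: dvdz_trans Nx.
have d_N : (d %| N)%N by apply: dvdn_gcdl.
have d'_N : (d' %| N)%N by apply: dvdn_gcdl.
have d_yz : (d %| y - z)%Z by rewrite dvdzE dvdn_gcdr.
have d'_yz : (d' %| y + z)%Z by rewrite dvdzE dvdn_gcdr.
have odd_dvd (m : nat) : (m %| N)%N -> odd m by move=> mN; apply: dvdn_odd mN N_odd.
have p_odd (p : nat) : prime p -> (p %| N)%N -> coprimez p 2.
  by move=> p_pr pN; rewrite coprimezE coprimen2 odd_dvd.
have no_p (p : nat) : prime p -> (p %| N)%N -> (p %| y)%Z ->
    (p %| y - z)%Z \/ (p %| y + z)%Z -> False.
  move=> p_pr pN py pyz; apply: (gn p p_pr (p4N _ pN) (dvd_x _ pN) py).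
  case: pyz => pz.
    have -> : z = y - (y - z) by ring.
    by rewrite rpredB.
  have -> : z = (y + z) - y by ring.
  by rewrite rpredB.
have co_dd' : coprimez d d'.
  apply: coprimez_primes => [|p p_pr pd pd']; first by rewrite eqz_nat -lt0n gcdn_gt0 N_gt0.
  have pN : (p %| N)%N := dvdn_trans pd d_N.
  apply: (no_p p p_pr pN _ (or_introl (dvdz_trans pd d_yz))).
  rewrite -(Gauss_dvdzr _ (p_odd _ p_pr pN)).
  have -> : 2 * y = (y - z) + (y + z) by ring.
  by rewrite rpredD ?(dvdz_trans pd d_yz) ?(dvdz_trans pd' d'_yz).
have NE : N = (d * d')%N.
  apply/eqP; rewrite eqn_dvd; apply/andP; split; last by rewrite Gauss_dvd // d_N.
  by apply: dvdn_gcdM; rewrite -abszM.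
have co_y : coprimez y N.
  rewrite coprimez_sym; apply: coprimez_primes => // p p_pr pN py.
  apply: (no_p p p_pr pN py).
  move: (pN); rewrite NE PoszM Euclid_dvdzM // => /orP[] pd; [left|right].
    exact: dvdz_trans pd d_yz.
  exact: dvdz_trans pd d'_yz.
have coN2 : coprimez 2 N by rewrite coprimezE coprime2n.
have co1 : coprimez 1 4 by [].
(* [q] sends [y] to 2 modulo [N] and is 1 modulo 4, so the residues of [y] and [z] modulo 4 are
   kept. *)
have [|q] := unit_mult _ co_y coN2 co1 co1; first by rewrite coprimez_sym.
rewrite mulr1 mulrC => co_q /andP[qyN q1].
have /dvdzP[e xe] := Nx.
have e_odd : ~~ (2 %| e)%Z.
  by apply: contra x_odd => e2; rewrite xe dvdz_mulr.
have xN : (2 * N%:Z %| x - N%:Z)%Z.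
  have -> : x - N%:Z = (e - 1) * N%:Z by rewrite xe; ring.
  by apply: dvdz_mul => //; move: e_odd; clear; lia.
have q_odd : (2 %| q - 1)%Z by move: q1; clear; lia.
have qx := dvdz_odd_mult (dvdz_odd_mulr xN q_odd).
have qz4 : (4 %| q * z)%Z by rewrite dvdz_mull.
have qy : (4 * N%:Z %| q * y - 2)%Z.
  rewrite dvd4N qyN andbT.
  have -> : q * y - 2 = (q - 1) * y + (y - 2) by ring.
  by rewrite rpredD // dvdz_mulr.
have q_unit := unit_intr Z4N_gt1 co_q.
have scale z' : (4 * N%:Z %| q * z - z')%Z ->
    scale_set (q%:~R : 'Z_(4 * N)) (pmz (4 * N) x y z) = pm3 2 N%:R z'%:~R.
  move=> qz; have -> : pm3 2 N%:R z'%:~R = pmz (4 * N) 2 N z' by [].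
  rewrite [in RHS]pmz_swap12; case: qx => qx.
    exact: (scale_pmz Z4N_gt1).
  rewrite -[in RHS]pmz_opp1; apply: (scale_pmz Z4N_gt1) => //.
  by case/dvdzP: qx => k qx; apply/dvdzP; exists (- k); rewrite mulNr -qx; ring.
have [d1|d_ne1] := eqVneq d 1%N.
  apply: Or42; exists q%:~R => //.
  have -> : 2 * N%:R - 2 = (2 * N%:Z - 2)%:~R :> 'Z_(4 * N).
    by rewrite rmorphB rmorphM /= -!pmulrn.
  apply: scale; rewrite dvd4N; apply/andP; split.
    (* Here [z = - y] modulo [N], so [q * z] is -2 modulo [N] and 0 modulo 4, as is [2 * N - 2]. *)
    have N24 : (4 %| 2 * N%:Z - 2)%Z by move: N_odd; clear; lia.
    by rewrite rpredB.
  move: d'_yz; have -> : d' = N by rewrite [RHS]NE d1 mul1n.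
  move=> yzN; have -> : q * z - (2 * N%:Z - 2) = q * (y + z) - (q * y - 2) - 2 * N%:Z by ring.
  by apply: rpredB; [apply: rpredB | ]; rewrite // dvdz_mull.
have d_gt1 : (1 < d)%N.
  by move: d_ne1 d_N; case: (d) => [|[|k]] // _; rewrite dvd0n => /eqP N0; move: N_gt0; rewrite N0.
have lt_dd' : (d < d')%N.
  rewrite ltn_neqAle le_dd' andbT; apply: contra d_ne1 => /eqP dE.
  by move: co_dd'; rewrite coprimezE /= -dE /coprime gcdnn.
apply: Or43; exists d, d'; split.
  split; rewrite ?odd_dvd ?d_gt1 ?lt_dd' //=.
  by rewrite [X in (_ < X)%N]NE ltn_Pmull // (ltn_trans _ lt_dd') // ltnW.
have [c' c'_lt c'z] := nat_residue (q * z).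
have c'_sys (c1 : nat) : c'_system_iii (4 * N) d d' c1 <->
    [/\ (1 < c1 < 4 * N)%N, (4 %| c1%:Z)%Z, (d %| c1%:Z - 2)%Z & (d' %| c1%:Z + 2)%Z].
  split=> [[h1 /eqz_modP h2 /eqz_modP h3 /eqz_modP h4]|[h1 h2 h3 h4]].
    by rewrite subr0 in h2; rewrite opprK in h4.
  by split=> //; apply/eqz_modP; rewrite ?subr0 ?opprK.
have c'4 : (4 %| c'%:Z)%Z.
  have -> : c'%:Z = (c'%:Z - q * z) + q * z by ring.
  by apply: rpredD => //; apply: dvdz_trans c'z; apply: dvdz_mulr.
have mc' (m : nat) : (m %| N)%N -> (m %| c'%:Z - q * z)%Z /\ (m %| q * y - 2)%Z.
  move=> mN; split; last by apply: dvdz_trans qyN.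
  by apply: dvdz_trans c'z; apply: dvdz_mull.
have c'd : (d %| c'%:Z - 2)%Z.
  have [h1 h2] := mc' _ d_N.
  have -> : c'%:Z - 2 = (c'%:Z - q * z) + (q * y - 2) - q * (y - z) by ring.
  by apply: rpredB; [apply: rpredD | apply: dvdz_mull].
have c'd' : (d' %| c'%:Z + 2)%Z.
  have [h1 h2] := mc' _ d'_N.
  have -> : c'%:Z + 2 = (c'%:Z - q * z) - (q * y - 2) + q * (y + z) by ring.
  by apply: rpredD; [apply: rpredB | apply: dvdz_mull].
exists c'.
  split.
    apply/c'_sys; split=> //; rewrite c'_lt andbT.
    rewrite ltnNge; apply/negP => c'_le1.
    (* A zero residue would make [d] divide 2, impossible for an odd [d > 1]. *)
    have c'0 : c' = 0%N by move: c'4 c'_le1; clear; lia.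
    have d2 : (d <= 2)%N by rewrite dvdn_leq //; move: c'd; rewrite c'0.
    by move: (odd_dvd _ d_N) d_gt1 d2; case: (d) => [|[|[]]].
  move=> c1 /c'_sys[/andP[_ c1_lt] c14 c1d c1d']; apply: eq_residue => //.
  rewrite dvd4N rpredB //= NE PoszM Gauss_dvdz //; apply/andP; split.
    have -> : c'%:Z - c1%:Z = (c'%:Z - 2) - (c1%:Z - 2) by ring.
    by rewrite rpredB.
  have -> : c'%:Z - c1%:Z = (c'%:Z + 2) - (c1%:Z + 2) by ring.
  by rewrite rpredB.
exists q%:~R => //; have -> : c'%:R = c'%:Z%:~R :> 'Z_(4 * N) by [].
apply: scale; have -> : q * z - c'%:Z = - (c'%:Z - q * z) by ring.
by rewrite rpredN.
Qed.

(** Replacing [z] by [- z] exchanges the two gcds, so their order can be assumed. *)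
Lemma even_pair x y z : admissible x y z -> ~~ (2 %| x)%Z ->
  (4 %| y - 2)%Z -> (4 %| z)%Z -> classified x y z.
Proof.
move=> adm x_odd y2 z4.
have [le|/ltnW le] := leqP (gcdn N `|(y - z)%R|) (gcdn N `|(y + z)%R|).
  exact: even_pair_le.
apply/classified_opp3/even_pair_le => //; last by rewrite opprK.
  exact: admissible_opp3.
by rewrite rpredN.
Qed.

Lemma coprimez_odd4 x : ~~ (2 %| x)%Z -> coprimez x 4.
Proof.
by rewrite coprimezE -[X in coprime _ X]/(2 ^ 2)%N coprime_pexpr // coprimen2 dvdzE dvdn2 negbK.
Qed.

(** The residues modulo 4 make [y - z] a multiple of 4, which excludes the minus sign. *)
Lemma role_sum j x y z : (4 %| y - 1)%Z -> (4 %| z - 1)%Z -> role j x y z ->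
  (N %| j * (y + z))%Z.
Proof.
move=> y1 z1 /role_parity[_ [[yz _]|[_ //]]].
by exfalso; move: y1 z1 yz; clear; lia.
Qed.

(** For a prime [p] of [N], a multiplier prime to [p] makes [p] divide one generator and the sum of
    the other two. Dividing two generators would mean dividing all three, so a prime of [gcdn N |x|]
    forces the role of [x]. *)
Lemma odd_triple_facts x y z : admissible x y z ->
  (4 %| x - 1)%Z -> (4 %| y - 1)%Z -> (4 %| z - 1)%Z ->
  (forall p : nat, prime p -> (p %| N)%N -> (p %| x)%Z -> (p %| y)%Z -> False) /\
  (gcdn N `|x| %| y + z)%Z.
Proof.
move=> [sp gn] x1 y1 z1.
have p4N (p : nat) : (p %| N)%N -> (p %| 4 * N)%N by apply: dvdn_mull.
have split_p (p : nat) j w : prime p -> (p %| N)%N -> ~~ (p %| j)%Z -> (N %| j * w)%Z -> (p %| w)%Z.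
  move=> p_pr pN pj Njw; have: (p %| j * w)%Z by apply: dvdz_trans Njw.
  by rewrite Euclid_dvdzM // (negPf pj).
have no_p (p : nat) : prime p -> (p %| N)%N -> (p %| x)%Z -> (p %| y)%Z -> False.
  move=> p_pr pN px py; apply: (gn p p_pr (p4N _ pN) px py).
  have [j pj r] := sp p p_pr (p4N _ pN).
  have pw w := split_p p j w p_pr pN pj.
  case: r => r.
  - have -> : z = (y + z) - y by ring.
    by apply: rpredB => //; apply: pw; apply: role_sum r.
  - have -> : z = (x + z) - x by ring.
    by apply: rpredB => //; apply: pw; apply: role_sum r.
  - by apply: pw; apply: role_dvdN r.
split=> //; apply: dvdz_by_primes => [|p p_pr].
  by rewrite gcdn_gt0 N_gt0.
rewrite dvdn_gcd => /andP[pN px].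
have [j pj r] := sp p p_pr (p4N _ pN); exists j => //.
have pw w := split_p p j w p_pr pN pj.
have gN : (gcdn N `|x| %| N%:Z)%Z by rewrite dvdzE dvdn_gcdl.
case: r => r.
- by apply: dvdz_trans (role_sum y1 z1 r).
- by exfalso; apply: (no_p p) => //; apply: pw; apply: role_dvdN r.
- exfalso; apply: (no_p p) => //.
  have -> : y = (x + y) - x by ring.
  by apply: rpredB => //; apply: pw; apply: role_sum r.
Qed.

(** Every role makes one generator a multiple of [N] after multiplication by [j], hence [N] divides
    [x * y * z]; no prime of [N] divides two of the generators. *)
Lemma odd_triple_factor x y z : admissible x y z ->
  (4 %| x - 1)%Z -> (4 %| y - 1)%Z -> (4 %| z - 1)%Z ->
  [/\ coprime (gcdn N `|x|) (gcdn N `|y|), coprime (gcdn N `|x|) (gcdn N `|z|),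
      coprime (gcdn N `|y|) (gcdn N `|z|)
    & N = (gcdn N `|x| * gcdn N `|y| * gcdn N `|z|)%N].
Proof.
move=> adm x1 y1 z1.
have co u v : (forall p : nat, prime p -> (p %| N)%N -> (p %| u)%Z -> (p %| v)%Z -> False) ->
    coprime (gcdn N `|u|) (gcdn N `|v|).
  move=> uv; suff: coprimez (gcdn N `|u|) (gcdn N `|v|) by [].
  apply: coprimez_primes => [|p p_pr]; first by rewrite eqz_nat -lt0n gcdn_gt0 N_gt0.
  by rewrite !dvdzE /= !dvdn_gcd => /andP[pN pu] /andP[_ pv]; apply: (uv p).
have xy := co _ _ (odd_triple_facts adm x1 y1 z1).1.
have xz := co _ _ (odd_triple_facts (admissible_swap23 adm) x1 z1 y1).1.
have yz := co _ _ (odd_triple_facts (admissible_swap23 (admissible_swap12 adm)) y1 z1 x1).1.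
split=> //; apply/eqP; rewrite eqn_dvd; apply/andP; split; last first.
  by rewrite !Gauss_dvd ?dvdn_gcdl // coprimeMl xz.
suff Nxyz : (N %| `|x| * `|y| * `|z|)%N.
  apply: dvdn_trans (dvdn_gcdM Nxyz) _; apply: dvdn_mul => //.
  have := @dvdn_gcdM (gcdn N (`|x| * `|y|)) `|x| `|y| (dvdn_gcdr _ _).
  move/dvdn_trans; apply; apply: dvdn_mul; rewrite dvdn_gcd dvdn_gcdr andbT.
    by apply: dvdn_trans (dvdn_gcdl _ _) (dvdn_gcdl _ _).
  by apply: dvdn_trans (dvdn_gcdl _ _) (dvdn_gcdl _ _).
suff : (N %| x * y * z)%Z by rewrite dvdzE !abszM.
case: adm => sp _; apply: dvdz_by_primes => // p p_pr pN.
have [j pj r] := sp p p_pr (dvdn_mull _ pN); exists j => //.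
case: r => /role_dvdN r.
- by rewrite !mulrA -[_ * y * z]mulrA dvdz_mulr.
- have -> : j * (x * y * z) = (j * y) * (x * z) by ring.
  by rewrite dvdz_mulr.
- have -> : j * (x * y * z) = (j * z) * (x * y) by ring.
  by rewrite dvdz_mulr.
Qed.

(** The third gcd is then all of [N], so [z] is an odd multiple of [N] and [N] divides [x + y]; the
    generators in condition (i) come from [z], [x] and [- y]. *)
Lemma odd_triple_i x y z : admissible x y z ->
  (4 %| x - 1)%Z -> (4 %| y - 1)%Z -> (4 %| z - 1)%Z ->
  gcdn N `|x| = 1%N -> gcdn N `|y| = 1%N -> classified x y z.
Proof.
move=> adm x1 y1 z1 gx gy.
have [_ _ _] := odd_triple_factor adm x1 y1 z1; rewrite gx gy !mul1n => gz.
have := (odd_triple_facts (admissible_swap12 (admissible_swap23 adm)) z1 x1 y1).2.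
rewrite -gz => Nxy.
have Nz : (N %| z)%Z by rewrite dvdzE gz dvdn_gcdr.
apply/classified_swap23/classified_swap12/classified_opp3; apply: Or41.
apply: condition_i_intro.
- rewrite coprimezMr coprimez_odd4 /=; last by move: x1; clear; lia.
  by rewrite coprimezE /coprime gcdnC gx.
- case/dvdzP: Nz => k zk; rewrite zk; have -> : k * N%:Z - N%:Z = (k - 1) * N%:Z by ring.
  apply: dvdz_mul => //; have := @Euclid_dvdzM 2 k N isT; rewrite -zk.
  by move: z1; clear; lia.
- rewrite dvd4N opprK; apply/andP; split; first by move: x1 y1 N_odd; clear; lia.
  by apply: rpredB => //; apply: dvdz_mull.
Qed.

(** The three gcds are [d], [d'], [d'']. The multiplier is fixed modulo [4 * d' * d''], where [x] is
    a unit, by sending [x] to [d], and modulo [d], where [y] is a unit, by sending [y] to [b']. *)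
Lemma odd_triple_iv x y z : admissible x y z ->
  (4 %| x - 1)%Z -> (4 %| y - 1)%Z -> (4 %| z - 1)%Z ->
  (gcdn N `|x| < gcdn N `|y|)%N -> (gcdn N `|y| < gcdn N `|z|)%N ->
  condition_iv N (pmz (4 * N) x y z).
Proof.
move=> adm x1 y1 z1.
have [no_xy d_yz] := odd_triple_facts adm x1 y1 z1.
have [no_xz d''_xy] : (forall p : nat, prime p -> (p %| N)%N -> (p %| z)%Z -> (p %| x)%Z -> False)
    /\ (gcdn N `|z| %| x + y)%Z.
  exact: odd_triple_facts (admissible_swap12 (admissible_swap23 adm)) z1 x1 y1.
have [_ d'_xz] := odd_triple_facts (admissible_swap12 adm) y1 x1 z1.
have [co_dd' co_dd'' co_d'd'' NE] := odd_triple_factor adm x1 y1 z1.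
have [d_N d'_N d''_N] := And3 (dvdn_gcdl N `|x|) (dvdn_gcdl N `|y|) (dvdn_gcdl N `|z|).
have d_x : (gcdn N `|x| %| x)%Z by rewrite dvdzE dvdn_gcdr.
have d'_y : (gcdn N `|y| %| y)%Z by rewrite dvdzE dvdn_gcdr.
have d''_z : (gcdn N `|z| %| z)%Z by rewrite dvdzE dvdn_gcdr.
move: d_yz d''_xy d'_xz co_dd' co_dd'' co_d'd'' NE d_N d'_N d''_N d_x d'_y d''_z.
move: (gcdn N `|x|) (gcdn N `|y|) (gcdn N `|z|) => d d' d''.
move=> d_yz d''_xy d'_xz co_dd' co_dd'' co_d'd'' NE d_N d'_N d''_N d_x d'_y d''_z lt_dd' lt_d'd''.
have odd_dvd (m : nat) : (m %| N)%N -> odd m by move=> mN; apply: dvdn_odd mN N_odd.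
have gt0_dvd (m : nat) : (m %| N)%N -> (0 < m)%N by apply: dvdn_gt0.
have d_gt0 := gt0_dvd _ d_N.
have d'_gt1 : (1 < d')%N by apply: leq_ltn_trans lt_dd'.
have co4 (m : nat) : (m %| N)%N -> coprimez 4 m.
  by move=> mN; rewrite coprimezE (@coprimeXl 2 2 m) // coprime2n odd_dvd.
have dvd_all w : (4 %| w)%Z -> (d %| w)%Z -> (d' %| w)%Z -> (d'' %| w)%Z -> (4 * N%:Z %| w)%Z.
  move=> w4 wd wd' wd''; rewrite dvd4N w4 /= NE !PoszM !Gauss_dvdz ?wd ?wd' ?wd'' //.
  by rewrite coprimezE abszM coprimeMl co_dd''.
have b_sys (b : nat) : b'_system_iv (4 * N) d d' d'' b <->
    [/\ (1 < b < 4 * N)%N, (4 %| b%:Z - (2 - d%:Z))%Z, (d' %| b%:Z)%Z, (d'' %| b%:Z + d%:Z)%Z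
      & gcdn b d = 1%N].
  split=> [[h1 /eqz_modP h2 /eqz_modP h3 /eqz_modP h4 h5]|[h1 h2 h3 h4 h5]].
    by rewrite subr0 in h3; rewrite opprK in h4.
  by split=> //; apply/eqz_modP; rewrite ?subr0 ?opprK.
have c_sys (b c : nat) : c'_system_iv (4 * N) d d' d'' b c <->
    [/\ (1 < c < 4 * N)%N, (4 %| c%:Z - (2 - d%:Z))%Z, (d %| c%:Z + b%:Z)%Z,
        (d' %| c%:Z + d%:Z)%Z & (d'' %| c%:Z)%Z].
  split=> [[h1 /eqz_modP h2 /eqz_modP h3 /eqz_modP h4 /eqz_modP h5]|[h1 h2 h3 h4 h5]].
    by rewrite opprK in h3; rewrite opprK in h4; rewrite subr0 in h5.
  by split=> //; apply/eqz_modP; rewrite ?subr0 ?opprK.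
(* The congruence modulo 4 makes [m] odd, hence nonzero, and the divisor [e] excludes 1. *)
have gt1_dvd (m e : nat) : (1 < e)%N -> (e %| m%:Z)%Z -> (4 %| m%:Z - (2 - d%:Z))%Z -> (1 < m)%N.
  move=> e_gt1 em m4; have : odd m by move: (odd_dvd _ d_N) m4; clear; lia.
  case: m em {m4} => [|[|m]] //; rewrite dvdzE /= dvdn1 => /eqP e1.
  by move: e_gt1; rewrite e1.
have co_x : coprimez x (4 * (d' * d'')%:Z).
  rewrite PoszM !coprimezMr coprimez_odd4 /=; last by move: x1; clear; lia.
  apply/andP; split; rewrite coprimez_sym; apply: coprimez_primes => [|p p_pr pd px].
  - by rewrite eqz_nat -lt0n gt0_dvd.
  - apply: (no_xy p) => //; first exact: dvdn_trans pd d'_N.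
    exact: dvdz_trans d'_y.
  - by rewrite eqz_nat -lt0n gt0_dvd.
  - apply: (no_xz p) => //; first exact: dvdn_trans pd d''_N.
    exact: dvdz_trans d''_z.
have co_y : coprimez y d.
  rewrite coprimez_sym; apply: coprimez_primes => [|p p_pr pd py].
    by rewrite eqz_nat -lt0n.
  apply: (no_xy p) => //; first exact: dvdn_trans pd d_N.
  exact: dvdz_trans d_x.
have co_d : coprimez (4 * (d' * d'')%:Z) d.
  rewrite coprimezMl co4 //= coprimezE /= coprimeMl.
  by rewrite coprime_sym co_dd' coprime_sym co_dd''.
(* The residue [r] of [q * y] modulo [d] is free among units; it is used with 1 and then with
   [b']. *)
have scale_mod r : coprimez r d -> exists2 q : int, coprimez q (4 * N%:Z) &
    (4 * (d' * d'')%:Z %| q * x - d%:Z)%Z && (d %| q * y - r)%Z.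
  move=> co_r; have co_d' : coprimez d (4 * (d' * d'')%:Z) by rewrite coprimez_sym.
  have [q q_co qxy] := unit_mult co_d co_x co_d' co_y co_r.
  exists q => //; suff <- : 4 * (d' * d'')%:Z * d%:Z = 4 * N%:Z by [].
  by rewrite NE !PoszM; ring.
(* Modulo 4 all generators agree with [x] and go to [d], which equals [2 - d] because [d] is odd. *)
have mod4 q w : (4 %| w - 1)%Z -> (4 * (d' * d'')%:Z %| q * x - d%:Z)%Z ->
    (4 %| q * w - (2 - d%:Z))%Z.
  move=> w1 qx; have wx : (4 %| w - x)%Z by move: w1 x1; clear; lia.
  have d2 : (4 %| 2 * (d%:Z - 1))%Z by move: (odd_dvd _ d_N); clear; lia.
  have -> : q * w - (2 - d%:Z) = q * (w - x) + (q * x - d%:Z) + 2 * (d%:Z - 1) by ring.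
  apply: rpredD => //; apply: rpredD; first exact: dvdz_mull.
  by apply: dvdz_trans qx; apply: dvdz_mulr.
have res (m e : nat) w r : (e %| N)%N -> (4 * N%:Z %| m%:Z - w)%Z -> (e %| w - r)%Z ->
    (e %| m%:Z - r)%Z.
  move=> eN mw wr; have -> : m%:Z - r = (m%:Z - w) + (w - r) by ring.
  by apply: rpredD => //; apply: dvdz_trans mw; apply: dvdz_mull.
have res4 (m : nat) w r : (4 * N%:Z %| m%:Z - w)%Z -> (4 %| w - r)%Z -> (4 %| m%:Z - r)%Z.
  move=> mw wr; have -> : m%:Z - r = (m%:Z - w) + (w - r) by ring.
  by apply: rpredD => //; apply: dvdz_trans mw; apply: dvdz_mulr.
have xd'd'' q : (4 * (d' * d'')%:Z %| q * x - d%:Z)%Z ->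
    (d' %| q * x - d%:Z)%Z /\ (d'' %| q * x - d%:Z)%Z.
  move=> qx; split; apply: dvdz_trans qx; rewrite PoszM.
    by apply: dvdz_mull; apply: dvdz_mulr.
  by apply: dvdz_mull; apply: dvdz_mull.
have yd'' q : (4 * (d' * d'')%:Z %| q * x - d%:Z)%Z -> (d'' %| q * y - - d%:Z)%Z.
  move=> /xd'd''[_ qx]; have -> : q * y - - d%:Z = q * (x + y) - (q * x - d%:Z) by ring.
  by apply: rpredB => //; apply: dvdz_mull.
(* Sending [y] to 1 modulo [d] shows that the system has a solution, hence a smallest one. *)
have [b'0 b'0_sys] : exists b, b'_system_iv (4 * N) d d' d'' b.
  have [|q _ /andP[qx qy]] := scale_mod 1; first by rewrite coprimezE coprime1n.
  have [b b_lt bq] := nat_residue (q * y).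
  exists b; apply/b_sys.
  have b4 := res4 _ _ _ bq (mod4 _ _ y1 qx).
  have bd' : (d' %| b%:Z)%Z.
    by rewrite -[b%:Z]subr0; apply: res bq _ => //; rewrite subr0 dvdz_mull.
  split=> //.
  - by rewrite b_lt andbT (gt1_dvd _ d').
  - by rewrite -[d%:Z]opprK; apply: res bq (yd'' _ qx).
  - have := coprimez_mod (res _ _ _ _ d_N bq qy).
    by rewrite !coprimezE coprime1n => /eqP.
have [b' b'_min] : exists b', smallest (b'_system_iv (4 * N) d d' d'') b'.
  by apply: smallest_exists; exists b'0.
exists d, d', d''; split.
  split; rewrite ?NE ?odd_dvd ?co_dd' ?co_dd'' ?co_d'd'' ?d_gt0 ?lt_dd' ?lt_d'd'' //=.
  rewrite ltn_Pmull ?gt0_dvd //.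
  by apply: leq_trans d'_gt1 _; rewrite leq_pmull.
exists b' => //.
have /b_sys[b'_rng b'4 b'd' b'd'' b'd] := b'_min.1.
(* A new multiplier, now aimed at the smallest solution; [gcdn b' d = 1] makes this target a
   unit. *)
have [|q q_co /andP[qx qy]] := scale_mod b'%:Z; first by rewrite coprimezE /coprime b'd.
have [c' c'_lt c'z] := nat_residue (q * z).
have c'4 := res4 _ _ _ c'z (mod4 _ _ z1 qx).
have c'd : (d %| c'%:Z - - b'%:Z)%Z.
  apply: res c'z _ => //; have -> : q * z - - b'%:Z = q * (y + z) - (q * y - b'%:Z) by ring.
  by apply: rpredB => //; apply: dvdz_mull.
have c'd' : (d' %| c'%:Z - - d%:Z)%Z.
  apply: res c'z _ => //; have -> : q * z - - d%:Z = q * (x + z) - (q * x - d%:Z) by ring.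
  by apply: rpredB; [apply: dvdz_mull | case: (xd'd'' _ qx)].
have c'd'' : (d'' %| c'%:Z)%Z.
  by rewrite -[c'%:Z]subr0; apply: res c'z _ => //; rewrite subr0 dvdz_mull.
exists c'.
  split.
    apply/c_sys; rewrite opprK in c'd; rewrite opprK in c'd'; split=> //.
    by rewrite c'_lt andbT (gt1_dvd _ d'') // (ltn_trans d'_gt1).
  move=> c1 /c_sys[/andP[_ c1_lt] c14 c1d c1d' c1d'']; apply: eq_residue => //.
  have sub r : c'%:Z - c1%:Z = (c'%:Z - r) - (c1%:Z - r) by ring.
  apply: dvd_all.
  - by rewrite (sub (2 - d%:Z)) rpredB.
  - by rewrite (sub (- b'%:Z)); apply: rpredB; rewrite ?opprK // -[b'%:Z]opprK.
  - by rewrite (sub (- d%:Z)); apply: rpredB; rewrite ?opprK // -[d%:Z]opprK.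
  - by rewrite (sub 0) !subr0; apply: rpredB.
exists q%:~R; first exact: (@unit_intr (4 * N) Z4N_gt1 q q_co).
have -> : pm3 d%:R b'%:R c'%:R = pmz (4 * N) d%:Z b'%:Z c'%:Z by [].
apply: (scale_pmz Z4N_gt1).
- have [h1 h2] := xd'd'' _ qx; apply: dvd_all => //.
    by apply: dvdz_trans qx; apply: dvdz_mulr.
  by apply: rpredB => //; apply: dvdz_mull.
- apply: dvd_all => //.
  + have -> : q * y - b'%:Z = (q * y - (2 - d%:Z)) - (b'%:Z - (2 - d%:Z)) by ring.
    by rewrite rpredB // mod4.
  + by apply: rpredB => //; apply: dvdz_mull.
  + have -> : q * y - b'%:Z = (q * y - - d%:Z) - (b'%:Z + d%:Z) by ring.
    by apply: rpredB => //; apply: yd''.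
- have -> : q * z - c'%:Z = - (c'%:Z - q * z) by ring.
  by rewrite rpredN.
Qed.

(** Equal coprime gcds are both 1, so either the two smallest gcds are 1 or the chain is strict. *)
Lemma odd_triple_sorted x y z : admissible x y z ->
  (4 %| x - 1)%Z -> (4 %| y - 1)%Z -> (4 %| z - 1)%Z ->
  (gcdn N `|x| <= gcdn N `|y|)%N -> (gcdn N `|y| <= gcdn N `|z|)%N ->
  classified x y z.
Proof.
move=> adm x1 y1 z1 le_xy le_yz.
have [co_xy _ co_yz _] := odd_triple_factor adm x1 y1 z1.
have gx_gt0 : (0 < gcdn N `|x|)%N by rewrite gcdn_gt0 N_gt0.
have [gy1|gy_ne1] := eqVneq (gcdn N `|y|) 1%N.
  by apply: odd_triple_i => //; apply/eqP; rewrite eqn_leq gx_gt0 -{1}gy1 le_xy.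
apply: Or44; apply: odd_triple_iv => //; rewrite ltn_neqAle ?le_xy ?le_yz andbT.
  by apply: contra gy_ne1 => /eqP e; move: co_xy; rewrite e /coprime gcdnn.
by apply: contra gy_ne1 => /eqP e; move: co_yz; rewrite -e /coprime gcdnn.
Qed.

Lemma odd_triple x y z : admissible x y z ->
  (4 %| x - 1)%Z -> (4 %| y - 1)%Z -> (4 %| z - 1)%Z -> classified x y z.
Proof.
wlog le_xy : x y z / (gcdn N `|x| <= gcdn N `|y|)%N.
  move=> wl; have [|/ltnW] := leqP (gcdn N `|x|) (gcdn N `|y|); first exact: wl.
  by move=> le adm x1 y1 z1; apply/classified_swap12/wl => //; apply: admissible_swap12.
move=> adm x1 y1 z1.
have [le_yz|/ltnW le_zy] := leqP (gcdn N `|y|) (gcdn N `|z|).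
  exact: odd_triple_sorted.
have [le_xz|/ltnW le_zx] := leqP (gcdn N `|x|) (gcdn N `|z|).
  by apply/classified_swap23/odd_triple_sorted => //; apply: admissible_swap23.
apply/classified_swap23/classified_swap12/odd_triple_sorted => //.
exact/admissible_swap12/admissible_swap23.
Qed.

Lemma odd_sign x : ~~ (2 %| x)%Z -> (4 %| x - 1)%Z \/ (4 %| - x - 1)%Z.
Proof. by clear; lia. Qed.

(** Signs can be chosen so that all generators are 1 modulo 4. *)
Lemma odd_classified x y z : admissible x y z -> ~~ (2 %| x)%Z ->
  ~~ (2 %| y)%Z -> ~~ (2 %| z)%Z -> classified x y z.
Proof.
move=> adm /odd_sign x1 /odd_sign y1 /odd_sign z1.
wlog {x1} x1 : x adm / (4 %| x - 1)%Z.
  move=> wl; case: x1 => x1; first exact: wl.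
  by apply/classified_opp1/wl => //; apply: admissible_opp1.
wlog {y1} y1 : y adm / (4 %| y - 1)%Z.
  move=> wl; case: y1 => y1; first exact: wl.
  by apply/classified_opp2/wl => //; apply: admissible_opp2.
case: z1 => z1; first exact: odd_triple.
by apply/classified_opp3/odd_triple => //; apply: admissible_opp3.
Qed.

End OddQuarter.

(** For odd [N] one of [y - z], [y + z] is 2 modulo 4. So [y] and [z] have the same parity, and if
    even, exactly one of them is a multiple of 4. *)
Lemma role_classified x y z j : admissible x y z -> ~~ (2 %| j)%Z ->
  role j x y z -> classified x y z.
Proof.
move=> adm j_odd r; have [N_odd|N_even] := boolP (odd N); last first.
  have N2 : (2 %| N)%N by rewrite dvdn2.
  apply: Or41; case: r => jx [] jyz; first exact: even_condition_i jyz.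
  rewrite -pmz_opp3; apply: (even_condition_i N2 _ j_odd jx); last by rewrite opprK.
  exact: admissible_opp3.
have [x_odd yz] := role_parity N_odd r.
have [y_even|y_odd] := boolP (2 %| y)%Z; last first.
  by apply: odd_classified => //; move: y_odd yz; clear; lia.
have [[y2 z4]|[y4 z2]] : (4 %| y - 2)%Z /\ (4 %| z)%Z \/ (4 %| y)%Z /\ (4 %| z - 2)%Z.
- by move: y_even yz; clear; lia.
- exact: even_pair.
by apply/classified_swap23/even_pair => //; apply: admissible_swap23.
Qed.

Lemma admissible_classified x y z : admissible x y z -> classified x y z.
Proof.
move=> adm; have [|j j_odd] := adm.1 2%N isT; first by rewrite dvdn_mulr.
case=> r; first exact: role_classified adm j_odd r.
  by apply/classified_swap12/(role_classified _ j_odd r)/admissible_swap12.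
apply/classified_swap23/classified_swap12/(role_classified _ j_odd r).
exact/admissible_swap12/admissible_swap23.
Qed.

End Roles.

(** * From vanishing cosines to congruences *)

Section TypeOne.
Variables (R : realType) (n : nat).
Hypothesis n_gt1 : (1 < n)%N.

Lemma zeta_exprN1 (e : nat) : zeta R n ^+ e = -1 ->
  exists2 m : nat, n = (2 * m)%N & (n %| e%:Z - m%:Z)%Z.
Proof.
move=> we; have e_nz : ~~ (n %| e)%N.
  by rewrite (prim_order_dvd (zeta_prim R n_gt1)) we lt_eqF // (lt_trans (ltrN10 _) ltr01).
have /dvdnP[k ek] : (n %| 2 * e)%N.
  by rewrite (prim_order_dvd (zeta_prim R n_gt1)) mulnC exprM we sqrrN expr1n.
(* An even [k] would make [n] divide [e], so that [zeta ^+ e] would be 1. *)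
have k_odd : odd k.
  apply: contraR e_nz => k_even; have /dvdnP[h kh] : (2 %| k)%N by rewrite dvdn2.
  by apply/dvdnP; exists h; move: ek; rewrite kh; clear; lia.
have n_even : (2 %| n)%N.
  have : (2 %| k * n)%N by rewrite -ek dvdn_mulr.
  by rewrite Euclid_dvdM // dvdn2 k_odd.
have /dvdnP[m nm] := n_even; exists m; first by rewrite mulnC.
have kE := odd_double_half k; rewrite k_odd in kE.
apply/dvdzP; exists k./2%:Z; move: kE ek; rewrite nm -muln2 /=.
by move: (k./2) => h <-; clear; lia.
Qed.

(** Ratio [1 / 2] gives a zero cosine and ratios [r1], [1 - r1] give opposite ones. Sorting hides
    which generator has ratio [1 / 2], hence the disjunction. *)
Lemma type1_cos (a b c : 'Z_n) j : type1 R a b c j ->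
  cos (angle R j a) + cos (angle R j b) + cos (angle R j c) = 0 /\
  [\/ cos (angle R j a) = 0, cos (angle R j b) = 0 | cos (angle R j c) = 0].
Proof.
move=> [ra [rb [rc [[[_ ea] [_ eb] [_ ec]] [r1 [r2 [r3 [perm_r _ _ r2E r3E]]]]]]]].
rewrite -ea -eb -ec; pose g (r : R) : R := cos (pi * r).
have g2 : g r2 = 0 by rewrite /g r2E mul1r cos_pihalf.
have g3 : g r1 + g r3 = 0.
  by rewrite /g r3E mulrBr mulr1 cosB cospi sinpi; ring.
split.
  have := perm_big [:: ra; rb; rc] perm_r (op := +%R) (x := 0) (P := xpredT) (F := g).
  rewrite !big_cons !big_nil /= !addr0 => gE; rewrite -addrA -[LHS]gE addrCA g2 add0r.
  exact: g3.
have : r2 \in [:: ra; rb; rc] by rewrite -(perm_mem perm_r) !inE eqxx orbT.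
rewrite !inE => /or3P[] /eqP <-.
- exact: Or31.
- exact: Or32.
- exact: Or33.
Qed.

Lemma type1_roles (a b c : 'Z_n) j : type1 R a b c j ->
  exists2 N : nat, n = (4 * N)%N & roles N j (a : nat) (b : nat) (c : nat).
Proof.
move=> /type1_cos[sum0 one0].
have cos_role (x y z : 'Z_n) : cos (angle R j x) = 0 ->
    cos (angle R j y) + cos (angle R j z) = 0 ->
    exists2 N : nat, n = (4 * N)%N & role N j (x : nat) (y : nat) (z : nat).
  move=> x0 yz0; have [m nm nx] := zeta_exprN1 (cos_eq0_root x0).
  (* With [n = 2 * m], the even number [2 * j * x] is [m] modulo [n], so [m] is even. *)
  have /dvdnP[N mN] : (2 %| m)%N.
    suff: (2 %| m%:Z)%Z by [].
    case/dvdzP: nx => k; move: (j * x)%N => v; rewrite nm !PoszM => kx.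
    apply/dvdzP; exists (v%:Z - m%:Z * k).
    by transitivity (2 * v%:Z - k * (2 * m%:Z)); [rewrite -kx; ring | ring].
  have nE : n = (4 * N)%N by rewrite nm mN; lia.
  exists N => //.
  have half v : zeta R n ^+ v = -1 -> (4 * N%:Z %| v%:Z - 2 * N%:Z)%Z.
    move=> /zeta_exprN1[m' nm']; rewrite {1}nE; suff -> : m' = (2 * N)%N by [].
    by move: nm' nE; clear; lia.
  split.
    have := half _ (cos_eq0_root x0); rewrite -PoszM; move: (j * x)%N => v.
    have -> : (2 * v)%N%:Z - 2 * N%:Z = 2 * (v%:Z - N%:Z) by rewrite PoszM; ring.
    have -> : 4 * N%:Z = 2 * (2 * N%:Z) by ring.
    by rewrite dvdz_mul2l.
  have [eyz|/half] := cosN_root yz0; last by right; rewrite mulrDr -!PoszM -PoszD.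
  (* The factor [n.-1] stands for -1, keeping the exponent a natural number. *)
  have eyz1 : zeta R n ^+ (j * y + j * z * n.-1) = -1.
    rewrite exprD eyz mulNr -exprD -mulnS prednK ?(ltnW n_gt1) //.
    by rewrite mulnC exprM (prim_expr_order (zeta_prim R n_gt1)) expr1n.
  left; have := half _ eyz1; rewrite mulrBr -!PoszM.
  move: (j * y)%N (j * z)%N => u v; rewrite PoszD PoszM predn_int ?(ltnW n_gt1) // nE => h.
  have -> : u%:Z - v%:Z - 2 * N%:Z =
      u%:Z + v%:Z * ((4 * N)%:Z - 1) - 2 * N%:Z - v%:Z * (4 * N%:Z).
    by rewrite !PoszM; ring.
  by rewrite rpredB // dvdz_mull.
case: one0 => e0.
- have [|N nE r] := cos_role a b c e0; first by rewrite -[RHS]sum0 e0 add0r.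
  by exists N => //; apply: Or31.
- have [|N nE r] := cos_role b a c e0; first by rewrite -[RHS]sum0 e0 addr0.
  by exists N => //; apply: Or32.
- have [|N nE r] := cos_role c a b e0; first by rewrite -[RHS]sum0 e0 addr0.
  by exists N => //; apply: Or33.
Qed.
End TypeOne.

(** * Labellings *)

Section Labelling.

(** The multiples of [p] would form a subgroup containing the generators but not 1. *)
Lemma gen_no_common_prime (n p : nat) (a b c : 'Z_n) : (1 < n)%N ->
  (<<pm3 a b c>> = [set: 'Z_n])%g -> prime p -> (p %| n)%N ->
  (p %| a)%N -> (p %| b)%N -> (p %| c)%N -> False.
Proof.
move=> n_gt1 genS p_pr pn pa pb pc.
have pn' : (p %| (Zp_trunc n).+2)%N by rewrite Zp_cast.
have pN (x : 'Z_n) : (p %| x)%N -> (p %| (- x)%R)%N.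
  by move=> px; rewrite /= /dvdn modn_dvdm // -/(dvdn _ _) dvdn_sub.
have gH : group_set [set x : 'Z_n | (p %| x)%N].
  apply/group_setP; split=> [|x y]; rewrite !inE ?dvdn0 //= => px py.
  by rewrite /dvdn modn_dvdm // -/(dvdn _ _) dvdn_add.
have : (1 : 'Z_n)%R \in (<<pm3 a b c>>)%g by rewrite genS inE.
have /subsetP sub : (<<pm3 a b c>> \subset Group gH)%g.
  rewrite gen_subG; apply/subsetP => x; rewrite !inE -!orbA.
  by case/or4P => [||| /or3P[]] /eqP ->; rewrite ?pN.
move=> /sub; rewrite inE (@val_Zp_nat n n_gt1 1) modn_small // dvdn1 => /eqP p1.
by move: p_pr; rewrite p1.
Qed.

Lemma sum_pm3 (M : nmodType) (n : nat) (a b c : 'Z_n) (f : 'Z_n -> M) :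
  #|pm3 a b c| = 6%N ->
  \sum_(s in pm3 a b c) f s = f a + f (- a) + f b + f (- b) + f c + f (- c).
Proof.
move=> card6; pose r := [:: a; - a; b; - b; c; - c].
have rE : pm3 a b c =i r by move=> x; rewrite !inE -!orbA.
have r_uniq : uniq r by apply/card_uniqP; rewrite -(eq_card rE) card6.
rewrite (eq_bigl _ _ rE) -big_uniq //= !big_cons big_nil addr0 !addrA //.
Qed.

(** With multiplier 1 and [d] in place of [N], the role congruences say that the arguments pair off
    at odd multiples of [2 * d]. *)
Lemma antiperiodic_sum (d : nat) (F : int -> int) (x y z : int) :
  (forall t, F (t + 2 * d%:Z) = - F t) -> roles d 1 x y z ->
  forall t, F (t + x) + F (t - x) + F (t + y) + F (t - y) + F (t + z) + F (t - z) = 0.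
Proof.
move=> Fanti.
have Fper t k : F (t + k * (4 * d%:Z)) = F t.
  have Fper1 s : F (s + 4 * d%:Z) = F s.
    have -> : s + 4 * d%:Z = s + 2 * d%:Z + 2 * d%:Z by ring.
    by rewrite !Fanti opprK.
  elim/int_ind: k t => [|k IHk|k IHk] t; first by rewrite mul0r addr0.
    have -> : t + k.+1%:Z * (4 * d%:Z) = t + k%:Z * (4 * d%:Z) + 4 * d%:Z.
      by rewrite -addn1 PoszD; ring.
    by rewrite Fper1 IHk.
  rewrite -Fper1; have -> : t + - k.+1%:Z * (4 * d%:Z) + 4 * d%:Z = t + - k%:Z * (4 * d%:Z).
    by rewrite -addn1 PoszD; ring.
  exact: IHk.
have half u v : (4 * d%:Z %| u - v - 2 * d%:Z)%Z -> F u = - F v.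
  case/dvdzP=> k uv; rewrite -Fanti -(Fper (v + 2 * d%:Z) k); congr F.
  by rewrite -uv; ring.
have main u v w t : role d 1 u v w ->
    F (t + u) + F (t - u) + (F (t + v) + F (t - v) + (F (t + w) + F (t - w))) = 0.
  case; rewrite !mul1r => /dvdzP[k uE] vw.
  have -> : F (t + u) = - F (t - u).
    apply: half; apply/dvdzP; exists k.
    have -> : u = k * (2 * d%:Z) + d%:Z by rewrite -uE; ring.
    ring.
  rewrite addNr add0r; case: vw => /dvdzP[h vw].
    have -> : F (t + v) = - F (t + w).
      by apply: half; apply/dvdzP; exists h; rewrite -vw; ring.
    have -> : F (t - w) = - F (t - v).
      by apply: half; apply/dvdzP; exists h; rewrite -vw; ring.
    ring.
  have -> : F (t + v) = - F (t - w).
    by apply: half; apply/dvdzP; exists h; rewrite -vw; ring.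
  have -> : F (t + w) = - F (t - v).
    by apply: half; apply/dvdzP; exists h; rewrite -vw; ring.
  ring.
by case=> /main r t; rewrite -(r t); ring.
Qed.

Lemma label_surj (n : nat) (l : 'Z_n -> nat) : (1 < n)%N -> injective l ->
  (forall v, 1 <= l v <= n)%N ->
  forall k : nat, (1 <= k <= #|'Z_n|)%N <-> exists v, l v = k.
Proof.
move=> n_gt1 l_inj l_rng k; have -> : #|'Z_n| = n by rewrite card_ord Zp_cast.
split=> [k_rng|[v <-] //].
have s_uniq : uniq (map l (enum 'Z_n)) by rewrite map_inj_uniq ?enum_uniq.
have s_sub : {subset map l (enum 'Z_n) <= iota 1 n}.
  by move=> _ /mapP[v _ ->]; rewrite mem_iota addnC addn1 ltnS.
have [|_ s_eq] := uniq_min_size s_uniq s_sub.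
  by rewrite size_iota size_map -cardE card_ord Zp_cast.
have : k \in iota 1 n by rewrite mem_iota addnC addn1 ltnS.
by rewrite -s_eq => /mapP[v _ ->]; exists v.
Qed.

(* [G] is twice the labelling, shifted to mean zero. *)
Lemma distance_magic_label (n : nat) (S : {set 'Z_n}) (q : 'Z_n) (x y z : int)
    (lab : nat -> nat) (G : int -> int) :
  (1 < n)%N -> #|S| = 6%N -> q \is a GRing.unit -> scale_set q S = pmz n x y z ->
  {in gtn n &, injective lab} -> (forall k, k < n -> 1 <= lab k <= n)%N ->
  (forall k : nat, (k < n)%N -> 2 * (lab k)%:Z = n.+1%:Z + G k) ->
  (forall t u : int, (n %| t - u)%Z -> G t = G u) ->
  (forall t, G (t + x) + G (t - x) + G (t + y) + G (t - y) + G (t + z) + G (t - z) = 0) ->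
  distance_magic (circ S).
Proof.
move=> n_gt1 card6 q_unit qS lab_inj lab_rng labG Gper Gsum.
have ltn_Z (v : 'Z_n) : (v < n)%N by rewrite -[X in (_ < X)%N](Zp_cast n_gt1).
(* Labelling through [q * v] replaces [S] by its scaled copy. *)
pose l (v : 'Z_n) := lab (q * v)%R.
have l_inj : injective l.
  by move=> u v /lab_inj; rewrite !inE !ltn_Z => /(_ isT isT)/val_inj/(mulrI q_unit).
exists l; split=> //; first by apply: label_surj => // v; apply: lab_rng.
(* Twice a neighbour sum is [6 * n.+1] plus six values of [G], which cancel. *)
exists (3 * n.+1)%N => // v; rewrite sum_neighbours.
have scale_inj : injective ( *%R q) := mulrI q_unit.
have -> : (\sum_(s in S) l (v + s)%R)%N = (\sum_(t in pmz n x y z) lab (q * v + t)%R)%N.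
  rewrite -qS /scale_set (big_imset _ (in2W scale_inj)) /=.
  by apply: eq_bigr => s _; rewrite /l mulrDr.
have card6' : #|pmz n x y z| = 6%N by rewrite -qS card_imset.
rewrite (sum_pm3 _ card6').
pose m : int := ((q * v)%R : nat)%:Z.
have labE (w : int) : 2 * (lab (q * v + w%:~R)%R)%:Z = n.+1%:Z + G (m + w).
  rewrite labG //; congr (_ + _); apply: Gper.
  rewrite -(intr_Zp_eq n_gt1); apply/eqP.
  rewrite [RHS]intrD /m !intr_val. reflexivity.
apply/eqP; rewrite -eqz_nat; apply/eqP; apply: (@mulfI _ 2) => //.
rewrite !PoszD !mulrDr -!rmorphN !labE /= PoszM.
have := Gsum m; move: (G _) (G _) (G _) (G _) (G _) (G _) => g1 g2 g3 g4 g5 g6.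
by clear; lia.
Qed.

End Labelling.

(** * Explicit distance magic labellings *)

Section Constructions.
Variable N : nat.
Hypothesis N_gt1 : (1 < N)%N.

Lemma distance_magic_antipodal (S : {set 'Z_(4 * N)}) (q : 'Z_(4 * N)) (x y z : int) :
  #|S| = 6%N -> q \is a GRing.unit -> scale_set q S = pmz (4 * N) x y z ->
  roles N 1 x y z -> distance_magic (circ S).
Proof.
move=> card6 q_unit qS rxyz.
(* Antipodal vertices [k] and [k + 2 * N] get labels with sum [4 * N + 1], so the centred double [g]
   changes sign under this shift. *)
pose lab k := if (k < 2 * N)%N then k.+1 else (6 * N - k)%N.
pose g (m : int) : int := if m < 2 * N%:Z then 2 * m + 1 - 4 * N%:Z else 8 * N%:Z - 2 * m - 1.
pose G (t : int) := g (t %% (4 * N%:Z))%Z.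
have N4_gt0 : 0 < 4 * N%:Z by lia.
have G_red (t u : int) : 0 <= u < 4 * N%:Z -> (4 * N%:Z %| t - u)%Z -> G t = g u.
  move=> u_rng tu; rewrite /G; congr g; rewrite -(modz_small u_rng).
  by apply/eqP; rewrite eqz_mod_dvd.
apply: (distance_magic_label (lab := lab) (G := G) (Z4N_gt1 N_gt1) card6 q_unit qS).
- by move=> k1 k2; rewrite !inE /lab; do 2 case: ifP; clear -N_gt1; lia.
- by move=> k; rewrite /lab; case: ifP; clear -N_gt1; lia.
- move=> k k_lt; have k_rng : 0 <= k%:Z < 4 * N%:Z by move: k_lt; clear; lia.
  rewrite (G_red k k) // ?subrr ?dvdz0 // /lab /g.
  by do 2 case: ifP; move: k_lt; clear; lia.
- move=> t u tu; rewrite /G; congr g; apply/eqP; rewrite eqz_mod_dvd.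
  exact: tu.
apply: (antiperiodic_sum _ rxyz) => t.
pose u := (t %% (4 * N%:Z))%Z.
have u_ge0 : 0 <= u by rewrite modz_ge0 // gt_eqF.
have u_lt : u < 4 * N%:Z by rewrite ltz_pmod.
have tu : (4 * N%:Z %| t - u)%Z by rewrite -eqz_mod_dvd modz_mod.
rewrite {2}/G -/u; have [u_lt2|u_ge2] := ltrP u (2 * N%:Z).
  rewrite (G_red _ (u + 2 * N%:Z)).
  - by rewrite /g u_lt2; case: ifP; move: u_ge0; clear; lia.
  - by move: u_ge0 u_lt2; clear; lia.
  by have -> : t + 2 * N%:Z - (u + 2 * N%:Z) = t - u by ring.
rewrite (G_red _ (u - 2 * N%:Z)).
- by rewrite /g; do 2 case: ifP; move: u_lt u_ge2; clear; lia.
- by move: u_ge2 u_lt N_gt1; clear; lia.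
have -> : t + 2 * N%:Z - (u - 2 * N%:Z) = t - u + 4 * N%:Z by ring.
by rewrite rpredD.
Qed.

Lemma radix_lt (d m u w : nat) : (u < d)%N -> (w < m)%N -> (u + d * w < d * m)%N.
Proof.
move=> lt_ud lt_wm; apply: leq_trans (_ : d * w.+1 <= _)%N.
  by rewrite mulnS ltn_add2r.
by rewrite leq_mul2l lt_wm orbT.
Qed.

Lemma radix_inj (d u w u' w' : nat) : (u < d)%N -> (u' < d)%N ->
  (u + d * w = u' + d * w')%N -> u = u' /\ w = w'.
Proof.
move=> lt_ud lt_u'd e; have uE : u = u'.
  have := congr1 (modn^~ d) e.
  by rewrite /= ![(d * _)%N]mulnC ![(_ + _ * d)%N]addnC !modnMDl !modn_small.
split=> //; apply/eqP; move/eqP: e; rewrite uE eqn_add2l eqn_mul2l.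
by case: d lt_ud {lt_u'd uE}.
Qed.

(** The three factors may assign different roles, so no single antiperiod need serve. Each digit of
    the label instead depends on one factor and cancels by the role attached to that factor. *)
Lemma distance_magic_radix (d1 d2 d3 : nat) (S : {set 'Z_(4 * N)}) (q : 'Z_(4 * N))
    (x y z : int) : odd N -> N = (d1 * d2 * d3)%N ->
  coprime d1 d2 -> coprime d1 d3 -> coprime d2 d3 ->
  #|S| = 6%N -> q \is a GRing.unit -> scale_set q S = pmz (4 * N) x y z ->
  roles d1 1 x y z -> roles d2 1 x y z -> roles d3 1 x y z -> distance_magic (circ S).
Proof.
move=> N_odd NE co12 co13 co23 card6 q_unit qS r1 r2 r3.
have [d1N d2N d3N] : [/\ d1 %| N, d2 %| N & d3 %| N]%N.
  rewrite NE; split; last by rewrite dvdn_mull.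
    by rewrite -mulnA dvdn_mulr.
  by rewrite -mulnA mulnCA dvdn_mulr.
have d_gt0 (d : nat) : (d %| N)%N -> (0 < d)%N by apply: dvdn_gt0; apply: ltnW.
have d_odd (d : nat) : (d %| N)%N -> odd d by move=> dN; apply: dvdn_odd dN N_odd.
pose Y k := (k %% d1 + d1 * (k %% d2 + d2 * (k %% d3)))%N.
have Y_lt k : (Y k < N)%N.
  by rewrite NE -mulnA !radix_lt // ltn_pmod // d_gt0.
(* The residue modulo 4 selects a block of [N] labels; residues differing by 2, with equal digits,
   get labels of sum [4 * N + 1]. *)
pose lab k := if (k %% 4 == 0)%N then (Y k).+1 else
  if (k %% 4 == 1)%N then (N + Y k).+1 else
  if (k %% 4 == 2)%N then (4 * N - Y k)%N else (3 * N - Y k)%N.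
pose sg (t : int) : int := if (t %% 4)%Z < 2 then 1 else -1.
(* The constant and the parity term are unchanged by even shifts, so they can join the first
   digit. *)
pose h1 (t : int) : int :=
  2 * N%:Z * (t %% 2)%Z + 1 - 4 * N%:Z + 2 * (t %% d1)%Z.
pose G1 t := sg t * h1 t.
pose G2 t := sg t * (2 * d1%:Z * (t %% d2)%Z).
pose G3 t := sg t * (2 * (d1 * d2)%N%:Z * (t %% d3)%Z).
pose G t := G1 t + G2 t + G3 t.
(* As [d] is odd, [2 * d] is 2 modulo 4. *)
have sg_anti (d : nat) t : (d %| N)%N -> sg (t + 2 * d%:Z) = - sg t.
  move=> /d_odd; rewrite /sg; have := modz_ge0 t (isT : (4 : int) != 0).
  by clear; do 2 case: ifP; lia.
have modD (d : nat) (t : int) : ((t + 2 * d%:Z) %% d = t %% d)%Z.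
  by rewrite addrC modzMDl.
have G1_anti t : G1 (t + 2 * d1%:Z) = - G1 t.
  rewrite /G1 /h1 sg_anti // modD; have -> : ((t + 2 * d1%:Z) %% 2 = t %% 2)%Z.
    by rewrite addrC mulrC modzMDl.
  by rewrite mulNr.
have G2_anti t : G2 (t + 2 * d2%:Z) = - G2 t by rewrite /G2 sg_anti // modD mulNr.
have G3_anti t : G3 (t + 2 * d3%:Z) = - G3 t by rewrite /G3 sg_anti // modD mulNr.
apply: (distance_magic_label (lab := lab) (G := G) (Z4N_gt1 N_gt1) card6 q_unit qS).
- move=> k1 k2; rewrite !inE => k1_lt k2_lt labE.
  have [k4 YE] : (k1 %% 4 = k2 %% 4 /\ Y k1 = Y k2)%N.
    have := ltn_pmod k1 (isT : 0 < 4)%N; have := ltn_pmod k2 (isT : 0 < 4)%N.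
    move: (Y_lt k1) (Y_lt k2) labE; rewrite /lab.
    move: (Y k1) (Y k2) (k1 %% 4)%N (k2 %% 4)%N; clear -N_gt1 => Y1 Y2 m1 m2.
    by case: m1 => [|[|[|[|?]]]]; case: m2 => [|[|[|[|?]]]] //=; lia.
  have [||e1 w1] := radix_inj _ _ YE; rewrite ?ltn_pmod ?d_gt0 //.
  have [||e2 e3] := radix_inj _ _ w1; rewrite ?ltn_pmod ?d_gt0 //.
  (* The label determines the residues modulo 4 and the three factors, hence the vertex. *)
  have co4 : coprime 4 N by rewrite (@coprimeXl 2 2 N) // coprime2n.
  rewrite -(modn_small k1_lt) -(modn_small k2_lt); apply/eqP.
  rewrite chinese_remainder // k4 eqxx NE chinese_remainder ?coprimeMl ?co13 //.
  by rewrite chinese_remainder // e1 e2 e3 !eqxx.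
- move=> k _; move: (Y_lt k); rewrite /lab; move: (Y k) (k %% 4)%N; clear => v m v_lt.
  by case: m => [|[|[|?]]] /=; lia.
- move=> k _; have GE : G k = sg k * (2 * N%:Z * (k %% 2)%N%:Z + 1 - 4 * N%:Z + 2 * (Y k)%:Z).
    by rewrite /G /G1 /G2 /G3 /h1 /Y !modz_nat !PoszD !PoszM !PoszD !PoszM; ring.
  rewrite GE /lab /sg modz_nat; move: (Y_lt k) (ltn_pmod k (isT : 0 < 4)%N).
  have -> : (k %% 2 = (k %% 4) %% 2)%N by rewrite modn_dvdm.
  move: (Y k) (k %% 4)%N; clear => v m v_lt m_lt.
  rewrite [(m %% 2)%N](_ : _ = nat_of_bool (odd m)) ?modn2 //.
  by case: m m_lt => [|[|[|[|?]]]] //= _; rewrite ?mulr0 ?mulr1; lia.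
- move=> t u tu; have dvd_mod (d : nat) : (d %| 4 * N)%N -> (t %% d = u %% d)%Z.
    move=> dN; apply/eqP; rewrite eqz_mod_dvd.
    by apply: dvdz_trans tu.
  rewrite /G /G1 /G2 /G3 /h1 /sg (dvd_mod 4) ?dvdn_mulr // (dvd_mod 2) ?dvdn_mulr //.
  by rewrite !dvd_mod // dvdn_mull.
move=> t; rewrite /G.
have s1 := antiperiodic_sum G1_anti r1 t.
have s2 := antiperiodic_sum G2_anti r2 t.
have s3 := antiperiodic_sum G3_anti r3 t.
by have := congr2 +%R (congr2 +%R s1 s2) s3; rewrite !addr0 => <-; ring.
Qed.

End Constructions.

(** In (i) and (ii) the generator [N] takes the first role modulo [N]. In (iii) it does so for each
    factor, and only the sign changes. In (iv) the first role passes from [d] to [b'] to [c'] for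
    the factors [d], [d'], [d'']. *)
Lemma condition_distance_magic (N : nat) (S : {set 'Z_(4 * N)}) : (1 < N)%N -> #|S| = 6%N ->
  [\/ condition_i N S, condition_ii N S, condition_iii N S | condition_iv N S] ->
  distance_magic (circ S).
Proof.
move=> N_gt1 card6.
have role1 d x y z : (2 * d%:Z %| x - d%:Z)%Z ->
    (4 * d%:Z %| y - z - 2 * d%:Z)%Z \/ (4 * d%:Z %| y + z - 2 * d%:Z)%Z -> role d 1 x y z.
  by move=> h1 h2; rewrite /role !mul1r.
have dvd4 (d : nat) (t : int) : odd d -> (4 %| t - 2)%Z -> (d %| t)%Z ->
    (4 * d%:Z %| t - 2 * d%:Z)%Z.
  move=> d_odd t4 td; rewrite Gauss_dvdz; last by rewrite coprimezE (@coprimeXl 2 2 d) // coprime2n.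
  apply/andP; split; first by move: t4 d_odd; clear; lia.
  by apply: rpredB => //; apply: dvdz_mull.
have dvd2 (d : nat) (t : int) : odd d -> (2 %| t - 1)%Z -> (d %| t)%Z -> (2 * d%:Z %| t - d%:Z)%Z.
  move=> d_odd t2 td; rewrite Gauss_dvdz; last by rewrite coprimezE coprime2n.
  apply/andP; split; first by move: t2 d_odd; clear; lia.
  by apply: rpredB.
case=> [[q q_unit qS]|[q q_unit qS]|[d [d' [[NE /andP[d_odd d'_odd] co _]]]]|
        [d [d' [d'' [[NE /and3P[d_odd d'_odd d''_odd] /and3P[co co' co''] _]]]]]].
- apply: (@distance_magic_antipodal N N_gt1 S q 1 N%:Z (2 * N%:Z - 1)) => //.
    by rewrite qS /pmz rmorphB rmorphM.
  apply: Or32; apply: role1; first by rewrite subrr dvdz0.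
  by right; rewrite [1 + _]addrC subrK subrr dvdz0.
- apply: (@distance_magic_antipodal N N_gt1 S q 2 N%:Z (2 * N%:Z - 2)) => //.
    by rewrite qS /pmz rmorphB rmorphM.
  apply: Or32; apply: role1; first by rewrite subrr dvdz0.
  by right; rewrite [2 + _]addrC subrK subrr dvdz0.
- move=> [c' [[c'_rng /eqz_modP c'4 /eqz_modP c'd /eqz_modP c'd'] _] [q q_unit qS]].
  have N_odd : odd N by rewrite NE oddM d_odd.
  rewrite subr0 in c'4; rewrite opprK in c'd'.
  have N2 : (2 %| N%:Z - 1)%Z by move: N_odd; clear; lia.
  have c4 : (4 %| 2 - c'%:Z - 2)%Z /\ (4 %| 2 + c'%:Z - 2)%Z by move: c'4; clear; lia.
  have r (e : nat) : (e %| N)%N -> odd e -> (e %| 2 - c'%:Z)%Z \/ (e %| 2 + c'%:Z)%Z ->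
      roles e 1 2 N%:Z c'%:Z.
    move=> eN e_odd ec; apply: Or32; apply: role1; first exact: dvd2.
    by case: ec => ec; [left|right]; apply: dvd4 => //; case: c4.
  (* A trivial third factor, whose role needs only the congruences modulo 4. *)
  apply: (@distance_magic_radix N N_gt1 d d' 1 S q 2 N%:Z c'%:Z) => //.
  + by rewrite NE muln1.
  + by rewrite coprimen1.
  + by rewrite coprimen1.
  + apply: r; rewrite ?NE ?dvdn_mulr //; left.
    have -> : 2 - c'%:Z = - (c'%:Z - 2) by ring.
    by rewrite rpredN.
  + by apply: r; rewrite ?NE ?dvdn_mull //; right; rewrite addrC.
  + by apply: r => //; left.
- move=> [b' [[b'_rng /eqz_modP b'4 /eqz_modP b'd' /eqz_modP b'd'' _] _]].
  move=> [c' [[c'_rng /eqz_modP c'4 /eqz_modP c'd /eqz_modP c'd' /eqz_modP c'd''] _]].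
  move=> [q q_unit qS]; rewrite subr0 in b'd'; rewrite opprK in b'd''.
  rewrite opprK in c'd; rewrite opprK in c'd'; rewrite subr0 in c'd''.
  have N_odd : odd N by rewrite NE !oddM d_odd d'_odd.
  apply: (@distance_magic_radix N N_gt1 d d' d'' S q d%:Z b'%:Z c'%:Z) => //.
  + apply: Or31; apply: role1; first by rewrite subrr dvdz0.
    right; apply: dvd4 => //; last by rewrite addrC.
    by move: b'4 c'4 d_odd; clear; lia.
  + apply: Or32; apply: role1.
      by apply: dvd2 => //; move: b'4 d_odd; clear; lia.
    right; apply: dvd4 => //; last by rewrite addrC.
    by move: c'4 d_odd; clear; lia.
  + apply: Or33; apply: role1.
      by apply: dvd2 => //; move: c'4 d_odd; clear; lia.
    right; apply: dvd4 => //; last by rewrite addrC.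
    by move: b'4 d_odd; clear; lia.
Qed.

Local Close Scope ring_scope.

Theorem theorem4p5 (R : realType) (n : nat) (hn : (7 <= n)%N)
    (a b c : 'Z_n) (S : {set 'Z_n}) (hS : S = pm3 a b c)
    (hcard : #|S| = 6) (hgen : (<<S>> = [set: 'Z_n])%g)
    (htype : forall j : 'I_n, j \in calA R S -> type1 R a b c j) :
  distance_magic (circ S) <->
  exists n0 : nat,
    [/\ (2 <= n0)%N,
        n = (4 * n0)%N
      & [\/ condition_i n0 S,
            condition_ii n0 S,
            condition_iii n0 S
          | condition_iv n0 S]].
Proof.
split=> [dm|[n0 [n0_gt1 nE cond]]]; last first.
  by move: n0_gt1 cond; subst n => n0_gt1; apply: condition_distance_magic.
have n_gt1 : (1 < n)%N by apply: leq_trans hn.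
have separated p : prime p -> (p %| n)%N -> exists2 j : nat, ~~ (p %| j)%N & type1 R a b c j.
  move=> p_pr pn; have [j /htype jtype pj] := calA_separates R n_gt1 dm p_pr pn.
  by exists j.
have [n0 nE] : exists n0, n = (4 * n0)%N.
  have [j _ /(type1_roles n_gt1)[n0 nE _]] := separated _ (pdiv_prime n_gt1) (pdiv_dvd n).
  by exists n0.
have n0_gt1 : (1 < n0)%N by move: hn; rewrite nE; clear; lia.
exists n0; split=> //.
have adm : admissible n0 (a : nat) (b : nat) (c : nat).
  split=> p p_pr; rewrite -nE => pn; last first.
    move=> pa pb pc; apply: (@gen_no_common_prime n p a b c) => //.
    by rewrite -hS.
  have [j pj /(type1_roles n_gt1)[m nm r]] := separated p p_pr pn.
  exists (Posz j) => //; have -> : n0 = m by move: nE; rewrite nm; clear; lia.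
  exact: r.
have := admissible_classified n0_gt1 adm.
by rewrite /classified -nE /pmz !intr_val -hS.
Qed.
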